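(* Let $\mathcal G$ be a random graph on the vertex set $V$ which satisfies the BK inequality, and suppose that for some $\alpha\in(d/2,d)$ there exists $C>0$ such that $\tau(x,y)\le C\, g_\alpha(x,y)$ for all $x,y\in V$. There exists a constant $\kappa>0$ such that for any $\varphi:V\to[0,\infty)$ satisfying $\|g_{2\alpha-d}*\varphi\|_\infty\le 1$, and any $x\in V$, $$\mathbb E\left[\exp\left(\kappa\cdot\sum_{y\in\mathcal C(x)}\varphi(y)\right)\right]\le 2.$$
   Context: $(V,d_V)$ is a countable metric space, with balls $B(x,r)=\{y\in V: d_V(x,y)\le r\}$, of polynomial volume growth: there are a real $d\ge 1$ and constants $c_1,c_2>0$ with $c_1 r^d\le |B(x,r)|\le c_2 r^d$ for all $x\in V$, $r\ge 1$. $\mathcal G$ is a random graph with deterministic vertex set $V$ and possibly random edge set; $\{x\longleftrightarrow y\}$ is the event that $x$ and $y$ are connected in $\mathcal G$, $\tau(x,y)=\mathbb P(x\longleftrightarrow y)$, and $\mathcal C(x)=\{y\in V:x\longleftrightarrow y\}$. For $\beta>0$, $g_\beta(x,y)=\frac{1}{1+d_V(x,y)^\beta}$. For $K:V\times V\to\mathbb R$ and $\varphi:V\to\mathbb R$, $K*\varphi(x)=\sum_{y\in V}K(x,y)\varphi(y)$, and $\|\varphi\|_\infty=\sup_{x\in V}|\varphi(x)|$. BK inequality: an event $E$ is increasing if whenever $\{\mathcal G=A\}\subseteq E$ for a fixed graph $A$ with vertex set $V$, then $\{\mathcal G=B\}\subseteq E$ for every graph $B$ on $V$ containing $A$ as a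 subgraph. A finite graph $A$ witnesses $E$ if $\{A\subseteq\mathcal G\}\subseteq E$. For increasing events $E,F$, $E\circ F$ is the event that there exist two finite subgraphs of $\mathcal G$ with disjoint edge sets, one witnessing $E$ and the other witnessing $F$. $\mathcal G$ satisfies the BK inequality if $\mathbb P(E\circ F)\le \mathbb P(E)\,\mathbb P(F)$ for all increasing events $E,F$. *)

(* Defs.v *)
From HB Require Import structures.
From mathcomp Require Import all_boot all_order all_algebra.
From mathcomp Require Import all_classical all_reals all_analysis.

Set Implicit Arguments.
Unset Strict Implicit.
Unset Printing Implicit Defensive.

Import Order.TTheory GRing.Theory Num.Theory.

Local Open Scope classical_set_scope.
Local Open Scope ring_scope.

(* Non-strict balls: the library's [ball] is strict, and its [closed_ball] is
   the topological closure of [ball], which may be smaller. *)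
Definition dball (R : realType) (V : metricType R) (x : V) (r : R) : set V :=
  [set y | mdist x y <= r].

(* [counting] is +oo on infinite sets, so the upper bound makes balls finite. *)
Definition polynomial_volume_growth (R : realType) (V : metricType R) (d : R) :=
  exists c1 c2 : R, [/\ 0 < c1, 0 < c2 & forall (x : V) (r : R), 1 <= r ->
    ((c1 * r `^ d)%:E <= counting (dball x r))%E /\
    (counting (dball x r) <= (c2 * r `^ d)%:E)%E].

Definition gker (R : realType) (V : metricType R) (beta : R) (x y : V) : R :=
  (1 + mdist x y `^ beta)^-1.

(* The sum over V is an [esum], hence meaningful when K and phi are
   nonnegative; its value may be +oo. *)
Definition kconv (R : realType) (V : choiceType) (K : V -> V -> R)
    (phi : V -> R) (x : V) : \bar R :=
  (\esum_(y in [set: V]) (K x y * phi y)%:E)%E.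

Definition supnorm (R : realType) (V : Type) (f : V -> \bar R) : \bar R :=
  ereal_sup [set `|f x|%E | x in [set: V]].

Record graph (V : eqType) := Graph {
  adj : rel V;
  adj_sym : symmetric adj;
  adj_irr : irreflexive adj }.

Section Graphs.
Variable V : eqType.
Implicit Types (A B H : graph V) (E F : set (graph V)).

Definition subgraph A B := forall x y, adj A x y -> adj B x y.

Definition edge_disjoint A B := forall x y, ~~ (adj A x y && adj B x y).

(* All graphs here have vertex set V, so a finite subgraph is encoded by its
   edges together with isolated vertices. *)
Definition finite_graph A := finite_set [set e : V * V | adj A e.1 e.2].

Definition connected_in H (x y : V) :=
  exists p : seq V, path (adj H) x p /\ last x p = y.

Definition component H (x : V) : set V := [set y | connected_in H x y].

(* Events about the random graph are sets of graphs, measurable for the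
   sigma-algebra generated by the presence of single edges. The event
   {G = A} is then the singleton of A, and {A is contained in G} is the set of
   graphs containing A, whichever sample space G is defined on. *)
Definition edge_event (e : V * V) : set (graph V) := [set H | adj H e.1 e.2].

Definition graph_event E := <<s range edge_event >> E.

Definition increasing_event E :=
  forall A, [set H | H = A] `<=` E ->
  forall B, subgraph A B -> [set H | H = B] `<=` E.

Definition witnesses A E := [set H | subgraph A H] `<=` E.

Definition disjoint_occurrence E F : set (graph V) :=
  [set H | exists A B,
    [/\ finite_graph A, finite_graph B, subgraph A H & subgraph B H] /\
    [/\ edge_disjoint A B, witnesses A E & witnesses B F]].

End Graphs.

Section RandomGraphs.
Context {disp : measure_display} {T : measurableType disp} {R : realType}.
Variables (V : eqType) (P : probability T R) (G : T -> graph V).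

Definition random_graph := forall x y : V, measurable [set w | adj (G w) x y].

Definition tau (x y : V) : \bar R := P [set w | connected_in (G w) x y].

Definition BK_inequality := forall E F : set (graph V),
  graph_event E -> graph_event F -> increasing_event E -> increasing_event F ->
  (P (G @^-1` disjoint_occurrence E F) <= P (G @^-1` E) * P (G @^-1` F))%E.

End RandomGraphs.

(* Main.v *)
Require Import Defs.
From HB Require Import structures.
From mathcomp Require Import all_boot all_order all_algebra.
From mathcomp Require Import all_classical all_reals all_analysis.
From mathcomp Require Import measurable_realfun.
From mathcomp Require Import zify lra.

Set Implicit Arguments.
Unset Strict Implicit.
Unset Printing Implicit Defensive.

Import Order.TTheory GRing.Theory Num.Theory.

Local Open Scope classical_set_scope.
Local Open Scope ring_scope.

(** The exponential moment is the power series, with coefficients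
    [kappa ^ n / n!], of the moments [m_n(x)] of the [phi]-weighted size of the
    cluster of [x], so it is enough to show that [m_n(x)] is at most
    [n! * A ^ n], uniformly in [x].

    Expanding the power, [m_n(x)] is the sum over points [y_1, ..., y_n] of
    [phi(y_1) ... phi(y_n)] times the probability that [x] is connected to all
    of them.  If [n >= 2], a minimal connected subgraph joining these points
    branches somewhere: there is a vertex [z] and a splitting of the points into
    two nonempty groups such that [x] is connected to [z], [z] to the first
    group and [z] to the second group by three edge-disjoint subgraphs
    ([branching_occurrence]).  The BK inequality, applied twice, bounds the
    probability of this by a product ([tree_graph_inequality]), and summing
    against [phi] yields the recursion [moment_recursion]
      [m_n(x) <= sum_z tau(x, z) sum_k C(n, k) m_k(z) m_(n-k)(z)].

    Let [h] be the potential of [phi] for the kernel [g_alpha].  Then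
    [m_1 <= C h], and the recursion can be closed on multiples of [h] because
    the sum over [z] of [g_alpha(x, z) h(z) ^ 2] is at most [K h(x)]
    ([potential_bounds]).  Indeed, expand [h(z)] in one of the two factors:
    by the triangle inequality [g_alpha(x, z) g_alpha(z, y)] is at most a
    constant times [g_alpha(x, y) (g_alpha(x, z) + g_alpha(z, y))], and
    what remains to be summed over [z] is the convolution of [g_alpha] with [h].
    The latter is bounded: the convolution of [g_alpha] with itself is at most a
    multiple of [g_(2 alpha - d)] ([gker_convolution]), and the potential of
    [phi] for this kernel is at most [1] by assumption.

    Dividing by [n!] leaves a Catalan-like recursion for the constants
    [m_n / (n! h)], solved by [B L ^ n / n ^ 2] ([conv_weights_le],
    [moment_bound]). *)

(** * Sums over countable sets *)

Section Esum.
Context {R : realType}.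
Local Open Scope ereal_scope.

Lemma ge0_le_esumT (T : choiceType) (a : T -> \bar R) x :
  (forall i, 0 <= a i) -> a x <= \esum_(i in [set: T]) a i.
Proof.
move=> a0; rewrite -[leLHS](esum_set1 (t := x))// esum_mkcond.
by apply: le_esum => i _; case: ifP.
Qed.

Lemma esum_swap (S T : choiceType) (a : S -> T -> \bar R) :
  (forall i j, 0 <= a i j) ->
  \esum_(i in [set: S]) \esum_(j in [set: T]) a i j =
  \esum_(j in [set: T]) \esum_(i in [set: S]) a i j.
Proof.
move=> a0; rewrite !esum_esum//.
rewrite (reindex_esum ([set: T] `*`` fun=> [set: S]) _ (fun x => (x.2, x.1)))//.
split=> //=; first by move=> [i j] [i' j'] _ _ /= [-> ->].
by move=> [i j] _; exists (j, i).
Qed.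

Lemma esumZl (T : choiceType) (c : \bar R) (a : T -> \bar R) :
  0 <= c -> (forall i, 0 <= a i) ->
  \esum_(i in [set: T]) (c * a i) = c * \esum_(i in [set: T]) a i.
Proof.
have leZ (c' : R) (b : T -> \bar R) : (0 <= c')%R -> (forall i, 0 <= b i) ->
    \esum_(i in [set: T]) (c'%:E * b i) <= c'%:E * \esum_(i in [set: T]) b i.
  move=> c0 b0; apply: ge_ereal_sup => _ /= [X [finX XI] <-].
  rewrite -ge0_mule_fsumr//; apply: lee_pmul => //; first exact: fsume_ge0.
  by apply: ereal_sup_ubound; exists X.
move=> c0 a0; case: c c0 => [c| |//] c0.
- move: c0; rewrite lee_fin le_eqVlt => /predU1P[<-|c0].
    by rewrite mul0e esum1// => i _; rewrite mul0e.
  apply/eqP; rewrite eq_le leZ//=; last exact: ltW.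
  have /(lee_wpmul2l (x := c%:E)) : \esum_(i in [set: T]) a i <=
      c^-1%:E * \esum_(i in [set: T]) (c%:E * a i).
    rewrite (le_trans _ (leZ _ _ _ _))//.
    - by apply: le_esum => i _; rewrite muleA -EFinM mulVf ?mul1e// gt_eqF.
    - by rewrite invr_ge0 ltW.
    - by move=> i; rewrite mule_ge0// lee_fin ltW.
  by rewrite muleA -EFinM divff ?gt_eqF// mul1e; apply; rewrite lee_fin ltW.
- have [a_eq0|/existsNP[i /eqP ai]] := pselect (forall i, a i = 0).
    by rewrite !esum1 ?mule0// => i _; rewrite a_eq0 mule0.
  have ai0 : 0 < a i by rewrite lt_neqAle eq_sym ai a0.
  have -> : \esum_(j in [set: T]) (+oo * a j) = +oo.
    apply/eqP; rewrite -leye_eq (le_trans _ (ge0_le_esumT i _))//.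
      by rewrite gt0_mulye.
    by move=> j; rewrite mule_ge0.
  by rewrite gt0_mulye// (lt_le_trans ai0)// ge0_le_esumT.
Qed.

Lemma esumZr (T : choiceType) (c : \bar R) (a : T -> \bar R) :
  0 <= c -> (forall i, 0 <= a i) ->
  \esum_(i in [set: T]) (a i * c) = (\esum_(i in [set: T]) a i) * c.
Proof.
by move=> c0 a0; rewrite muleC -esumZl//; apply: eq_esum => i _; rewrite muleC.
Qed.

End Esum.

Section IntegralEsum.
Context {d : measure_display} {T : measurableType d} {R : realType}.
Context (V : choiceType) (V_countable : countable [set: V]).
Local Open Scope ereal_scope.

(** Enumerating the countable index set turns the sum into a series, to which
    monotone convergence applies. *)
Lemma esum_countableE (f : V -> nat) (a : V -> \bar R) : (forall y, 0 <= a y) ->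
  \esum_(y in [set: V]) a y =
  \sum_(n <oo) \esum_(y in f @^-1` [set n]) a y.
Proof.
move=> a0; have -> : [set: V] = \bigcup_(n in [set: nat]) (f @^-1` [set n]).
  by apply/seteqP; split=> // y _; exists (f y).
rewrite esum_bigcupT//; last first.
  by move=> i j _ _ [y [/= <- <-]].
by rewrite nneseries_esumT// => n; apply: esum_ge0.
Qed.

Lemma esum_fiber (f : V -> nat) n : injective f ->
  f @^-1` [set n] = set0 \/ exists y, f @^-1` [set n] = [set y].
Proof.
move=> finj; have [fn0|/set0P[y fy]] := eqVneq (f @^-1` [set n]) set0.
  by left.
right; exists y; apply/seteqP; split=> [z /= fz|_ -> //].
by apply: finj; rewrite fz fy.
Qed.

Lemma countable_injT : exists f : V -> nat, injective f.
Proof.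
have /countable_injP[f finj] := V_countable; exists f => x y.
by apply: finj; rewrite inE.
Qed.

Lemma measurable_esum (F : V -> T -> \bar R) :
  (forall y, measurable_fun [set: T] (F y)) -> (forall y w, 0 <= F y w) ->
  measurable_fun [set: T] (fun w => \esum_(y in [set: V]) F y w).
Proof.
move=> mF F0; have [f finj] := countable_injT.
under eq_fun do rewrite (esum_countableE f)//.
apply: (@ge0_emeasurable_sum _ _ _ _ _ predT) => //.
  by move=> n w _ _; apply: esum_ge0.
move=> n _; have [->|[y ->]] := esum_fiber n finj.
  by under eq_fun do rewrite esum_set0; exact: measurable_cst.
by under eq_fun do rewrite esum_set1//; exact: mF.
Qed.

Lemma integral_esum (mu : {measure set T -> \bar R}) (F : V -> T -> \bar R) :
  (forall y, measurable_fun [set: T] (F y)) -> (forall y w, 0 <= F y w) ->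
  \int[mu]_w (\esum_(y in [set: V]) F y w) =
  \esum_(y in [set: V]) \int[mu]_w F y w.
Proof.
move=> mF F0; have [f finj] := countable_injT.
rewrite (esum_countableE f); last by move=> y; exact: integral_ge0.
under eq_integral do rewrite (esum_countableE f)//.
rewrite integral_nneseries//.
- apply: eq_eseriesr => n _; have [->|[y ->]] := esum_fiber n finj.
    by under eq_integral do rewrite esum_set0; rewrite integral0 esum_set0.
  under eq_integral do rewrite esum_set1//.
  by rewrite esum_set1//; exact: integral_ge0.
- move=> n; have [->|[y ->]] := esum_fiber n finj.
    by under eq_fun do rewrite esum_set0; exact: measurable_cst.
  by under eq_fun do rewrite esum_set1//; exact: mF.
- by move=> n w _; apply: esum_ge0.
Qed.

End IntegralEsum.

(** * Branching of finite connected subgraphs *)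

Section ListGraphs.
Variable V : eqType.
Implicit Types (H A B : graph V) (a b c : seq (V * V)) (x y z u v : V).

Definition list_adj a : rel V :=
  fun u v => (u != v) && (((u, v) \in a) || ((v, u) \in a)).

Lemma list_adj_sym a : symmetric (list_adj a).
Proof. by move=> u v; rewrite /list_adj eq_sym orbC. Qed.

Lemma list_adj_irr a : irreflexive (list_adj a).
Proof. by move=> u; rewrite /list_adj eqxx. Qed.

Definition graph_of a := Graph (list_adj_sym a) (list_adj_irr a).

Definition edges_in H a := all (fun e => adj H e.1 e.2) a.

Definition ends a := [seq e.1 | e <- a] ++ [seq e.2 | e <- a].

Fixpoint steps x (p : seq V) : seq (V * V) :=
  if p is y :: p' then (x, y) :: steps y p' else [::].

Lemma adj_graph_of_cat a b u v :
  adj (graph_of (a ++ b)) u v = adj (graph_of a) u v || adj (graph_of b) u v.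
Proof.
rewrite /= /list_adj !mem_cat -andb_orr; congr (_ && _).
by rewrite orbACA.
Qed.

Lemma subgraph_graph_of H a : edges_in H a -> subgraph (graph_of a) H.
Proof.
move=> /allP aH u v /andP[_ /orP[/aH //|/aH /=]].
by rewrite adj_sym.
Qed.

Lemma subgraph_catl a b : subgraph (graph_of a) (graph_of (a ++ b)).
Proof. by move=> u v; rewrite adj_graph_of_cat => ->. Qed.

Lemma subgraph_catr a b : subgraph (graph_of b) (graph_of (a ++ b)).
Proof. by move=> u v; rewrite adj_graph_of_cat => ->; rewrite orbT. Qed.

Lemma subgraph_trans A B H : subgraph A B -> subgraph B H -> subgraph A H.
Proof. by move=> AB BH u v /AB/BH. Qed.

Lemma finite_graph_of a : finite_graph (graph_of a).
Proof.
apply: (@sub_finite_set _ _ [set` a ++ [seq (e.2, e.1) | e <- a]]).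
  move=> [u v] /= /andP[_ /orP[uv|vu]]; rewrite /= mem_cat ?uv//.
  by apply/orP; right; apply/mapP; exists (v, u).
exact: finite_seq.
Qed.

Lemma adj_ends a u v : adj (graph_of a) u v -> u \in ends a /\ v \in ends a.
Proof.
rewrite /ends !mem_cat => /andP[_ /orP[] /[dup] /(map_f fst)/= -> /(map_f snd)/= ->];
by rewrite ?orbT.
Qed.

Lemma ends_cat a b v : v \in ends (a ++ b) = (v \in ends a) || (v \in ends b).
Proof. by rewrite /ends !map_cat !mem_cat orbACA. Qed.

Lemma ends_steps x p v : v \in ends (steps x p) -> v \in x :: p.
Proof.
elim: p x => //= y p IH x.
rewrite -cat1s ends_cat => /orP[|/IH]; rewrite !inE.
  by move=> /orP[->//|->]; rewrite orbT.
by move=> ->; rewrite orbT.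
Qed.

Lemma steps_cat x p q : steps x (p ++ q) = steps x p ++ steps (last x p) q.
Proof. by elim: p x => //= y p IH x; rewrite IH. Qed.

Lemma edges_in_steps H x p : edges_in H (steps x p) = path (adj H) x p.
Proof. by elim: p x => //= y p IH x; rewrite -IH. Qed.

Lemma edges_in_cat H a b : edges_in H (a ++ b) = edges_in H a && edges_in H b.
Proof. exact: all_cat. Qed.

Lemma connected_refl H x : connected_in H x x.
Proof. by exists [::]. Qed.

Lemma connected_trans H x y z :
  connected_in H x y -> connected_in H y z -> connected_in H x z.
Proof.
move=> [p [xp <-]] [q [yq <-]]; exists (p ++ q).
by rewrite cat_path xp last_cat.
Qed.

Lemma connected_edge H x y : adj H x y -> connected_in H x y.
Proof. by move=> xy; exists [:: y]; rewrite /= xy. Qed.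

Lemma connected_sym H x y : connected_in H x y -> connected_in H y x.
Proof.
move=> [p [xp <-]]; elim: p x xp => [|y' p IH] x /=.
  by move=> _; exact: connected_refl.
move=> /andP[xy /IH py]; apply: connected_trans py _.
by apply: connected_edge; rewrite adj_sym.
Qed.

Lemma connected_mono A H x y :
  subgraph A H -> connected_in A x y -> connected_in H x y.
Proof.
by move=> AH [p [xp <-]]; exists p; split => //; apply: sub_path xp => u v /AH.
Qed.

Lemma connected_steps H x p v : path (adj H) x p -> v \in x :: p ->
  connected_in (graph_of (steps x p)) x v.
Proof.
elim: p x => [|y p IH] x /=.
  by move=> _; rewrite inE => /eqP ->; exact: connected_refl.
move=> /andP[xy /IH{}IH]; rewrite inE => /predU1P[->|/IH yv].
  exact: connected_refl.
apply: (@connected_trans _ _ y).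
  apply: connected_edge; rewrite /= /list_adj inE eqxx andbT.
  by apply/negP => /eqP xEy; rewrite xEy adj_irr in xy.
by apply: connected_mono yv; exact: (@subgraph_catr [:: _]).
Qed.

Lemma edge_disjointC A B : edge_disjoint A B -> edge_disjoint B A.
Proof. by move=> AB u v; rewrite andbC AB. Qed.

Lemma edge_disjoint_catl a b A :
  edge_disjoint (graph_of a) A -> edge_disjoint (graph_of b) A ->
  edge_disjoint (graph_of (a ++ b)) A.
Proof.
by move=> aA bA u v; rewrite adj_graph_of_cat andb_orl negb_or aA bA.
Qed.

Lemma edge_disjoint_subl A B H :
  subgraph A B -> edge_disjoint B H -> edge_disjoint A H.
Proof.
move=> AB BH u v; apply: contra (BH u v) => /andP[/AB ->].
by [].
Qed.

(** Two walks that meet only at one vertex cannot share an edge, since an edge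
    has two distinct ends. *)
Lemma edge_disjoint_steps x p q : uniq (x :: p ++ q) ->
  edge_disjoint (graph_of (steps x p)) (graph_of (steps (last x p) q)).
Proof.
rewrite -cat_cons cat_uniq => /and3P[_ /hasPn pq _].
have common v : v \in ends (steps x p) -> v \in ends (steps (last x p) q) ->
    v = last x p.
  move=> /ends_steps vp /ends_steps; rewrite inE => /predU1P[//|/pq/=].
  by rewrite vp.
move=> u v; apply/negP => /andP[uv uv'].
have [up vp] := adj_ends uv; have [uq vq] := adj_ends uv'.
by have := adj_irr (graph_of (steps x p)) u; rewrite {2}(common u)// -(common v)// uv.
Qed.

(** Stopping a walk when it first enters [W] gives a walk none of whose edges
    lies inside [W], hence edge-disjoint from any graph living on [W]. *)
Lemma first_hit H (W : pred V) y p : path (adj H) y p -> W (last y p) ->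
  exists q, [/\ path (adj H) y q, W (last y q) &
    forall a, {subset ends a <= W} ->
      edge_disjoint (graph_of (steps y q)) (graph_of a)].
Proof.
elim: p y => [|y' p IH] y /=.
  move=> _ Wy; exists [::]; split=> // a aW u v.
  by apply/negP => /andP[/andP[]].
move=> /andP[yy' /IH{}IH] /IH[q [yq Wq qW]].
have [Wy|nWy] := boolP (W y).
  by exists [::]; split=> // a aW u v; apply/negP => /andP[/andP[]].
exists (y' :: q); split=> //=; first by rewrite yy'.
move=> a aW; rewrite -cat1s; apply: edge_disjoint_catl; last exact: qW.
move=> u v; apply/negP => /andP[/andP[_]]; rewrite !inE => uvE.
move=> /adj_ends[/aW Wu /aW Wv]; move: nWy.
by move: uvE => /orP[/eqP[<- _]|/eqP[<- _]]; rewrite ?[W _]Wu ?[W _]Wv.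
Qed.

End ListGraphs.

Section Branching.
Variable V : eqType.
Implicit Types (H : graph V) (a b : seq (V * V)) (x y z u v : V).

Definition all_connected (s : seq V) x : set (graph V) :=
  [set H | forall y, y \in s -> connected_in H x y].

Definition flip (m : bitseq) := map negb m.

(** A [branching] is a subgraph of [H] made of a trunk, the simple path [p] from
    [x] to the branch point [z], and of two edge-disjoint bunches of edges [a]
    and [b] growing from [z]; [m] tells which points of [s] are reached
    through [a], the other ones being reached through [b]. *)
Record branching H x (s : seq V) (m : bitseq) z (p : seq V) a b : Prop :=
  Branching {
    br_size : size m = size s;
    br_path : path (adj H) x p;
    br_uniq : uniq (x :: p);
    br_last : last x p = z;
    br_ina : edges_in H a;
    br_inb : edges_in H b;
    br_pa : edge_disjoint (graph_of (steps x p)) (graph_of a);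
    br_pb : edge_disjoint (graph_of (steps x p)) (graph_of b);
    br_ab : edge_disjoint (graph_of a) (graph_of b);
    br_ca : forall v, v \in ends a -> connected_in (graph_of a) z v;
    br_cb : forall v, v \in ends b -> connected_in (graph_of b) z v;
    br_ma : all_connected (mask m s) z (graph_of a);
    br_mb : all_connected (mask (flip m) s) z (graph_of b) }.

Lemma flipK m : flip (flip m) = m.
Proof. by rewrite /flip -map_comp map_id_in// => b _ /=; rewrite negbK. Qed.

Lemma branching_flip H x s m z p a b :
  branching H x s m z p a b -> branching H x s (flip m) z p b a.
Proof.
case=> *; split; rewrite ?size_map ?flipK//.
exact: edge_disjointC.
Qed.

Lemma mem_mask_flip (s : seq V) (m : bitseq) y : size m = size s ->
  y \in s -> (y \in mask m s) || (y \in mask (flip m) s).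
Proof.
elim: s m => // x s IH [|[] m]//= [/IH{}IH]; rewrite !inE => /predU1P[->|/IH].
- by rewrite eqxx.
- by case/orP => ->; rewrite ?orbT.
- by rewrite eqxx orbT.
- by case/orP => ->; rewrite ?orbT.
Qed.

(** A new walk hitting the trunk at [u] moves the branch point to [u]: the rest
    of the trunk joins [a] and [b], and the walk is the second bunch. *)
Lemma branching_trunk H x s m z p a b y q :
  branching H x s m z p a b -> path (adj H) y q -> last y q \in x :: p ->
  (forall c, c \in [:: steps x p; a; b] ->
    edge_disjoint (graph_of (steps y q)) (graph_of c)) ->
  exists p' a', branching H x (y :: s) (false :: nseq (size s) true)
    (last y q) p' a' (steps y q).
Proof.
move=> [sm Hp up lp Ha Hb pa pb ab ca cb ma mb] Hq hit disj.
have dp := disj _ (mem_head _ _); have da := disj a ltac:(by rewrite !inE eqxx orbT).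
have db := disj b ltac:(by rewrite !inE eqxx !orbT).
move: up Hp lp pa pb dp hit; set u := last y q.
move=> up Hp lp pa pb dp hit.
have [p1 [p2 [pE lastp1]]] : exists p1 p2, p = p1 ++ p2 /\ last x p1 = u.
  by case/splitPl: hit => p1 p2 <-; exists p1, p2.
move: pE up Hp lp pa pb dp => -> up.
rewrite cat_path steps_cat last_cat lastp1 => /andP[Hp1 Hp2] lp pa pb dp.
pose a' := steps u p2 ++ a ++ b.
have cp2 v : v \in u :: p2 -> connected_in (graph_of a') u v.
  move=> /(connected_steps Hp2); apply: connected_mono; exact: subgraph_catl.
have uz : connected_in (graph_of a') u z by rewrite -lp; apply: cp2; exact: mem_last.
have za v : connected_in (graph_of a) z v -> connected_in (graph_of a') u v.
  move=> zv; apply: connected_trans uz _; apply: connected_mono zv.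
  by apply: subgraph_trans (@subgraph_catr _ _ _); exact: subgraph_catl.
have zb v : connected_in (graph_of b) z v -> connected_in (graph_of a') u v.
  move=> zv; apply: connected_trans uz _; apply: connected_mono zv.
  by apply: subgraph_trans (@subgraph_catr _ _ _); exact: subgraph_catr.
exists p1, a'; split=> //.
- by rewrite /= size_nseq.
- by move: up; rewrite -cat_cons cat_uniq => /and3P[].
- by rewrite !edges_in_cat edges_in_steps Hp2 Ha.
- by rewrite edges_in_steps.
- apply: edge_disjointC; apply: edge_disjoint_catl; last apply: edge_disjoint_catl.
  + by apply: edge_disjointC; have := edge_disjoint_steps up; rewrite lastp1.
  + by apply: edge_disjointC; apply: edge_disjoint_subl pa; exact: subgraph_catl.
  + by apply: edge_disjointC; apply: edge_disjoint_subl pb; exact: subgraph_catl.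
- by apply: edge_disjoint_subl (edge_disjointC dp); exact: subgraph_catl.
- apply: edge_disjoint_catl; last apply: edge_disjoint_catl.
  + by apply: edge_disjoint_subl (edge_disjointC dp); exact: subgraph_catr.
  + exact: edge_disjointC.
  + exact: edge_disjointC.
- move=> v; rewrite !ends_cat => /or3P[/ends_steps/cp2//|/ca/za//|/cb/zb//].
- move=> v /ends_steps vq; apply: connected_trans (connected_steps Hq vq).
  by apply: connected_sym; apply: connected_steps Hq _; exact: mem_last.
- move=> v /=; rewrite mask_true// => /(mem_mask_flip sm)/orP[/ma/za//|/mb/zb//].
- move=> v /=; rewrite /flip map_nseq mask_false inE => /eqP ->.
  by apply: connected_sym; apply: connected_steps Hq _; exact: mem_last.
Qed.

(** A new walk hitting a bunch is absorbed by it, without moving the branch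
    point. *)
Lemma branching_bunch H x s m z p a b y q :
  branching H x s m z p a b -> path (adj H) y q -> last y q \in ends a ->
  (forall c, c \in [:: steps x p; a; b] ->
    edge_disjoint (graph_of (steps y q)) (graph_of c)) ->
  branching H x (y :: s) (true :: m) z p (steps y q ++ a) b.
Proof.
move=> [sm Hp up lp Ha Hb pa pb ab ca cb ma mb] Hq hit disj.
have dp := disj _ (mem_head _ _).
have db := disj b ltac:(by rewrite !inE eqxx !orbT).
have za v : connected_in (graph_of a) z v ->
    connected_in (graph_of (steps y q ++ a)) z v.
  by apply: connected_mono; exact: subgraph_catr.
have yu v : v \in y :: q -> connected_in (graph_of (steps y q ++ a)) y v.
  by move=> /(connected_steps Hq); apply: connected_mono; exact: subgraph_catl.
have zy : connected_in (graph_of (steps y q ++ a)) z y.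
  apply: connected_trans (za _ (ca _ hit)) _.
  by apply: connected_sym; apply: yu; exact: mem_last.
split=> //.
- by rewrite /= sm.
- by rewrite edges_in_cat edges_in_steps Hq.
- by apply: edge_disjointC; apply: edge_disjoint_catl => //; exact: edge_disjointC.
- exact: edge_disjoint_catl.
- move=> v; rewrite ends_cat => /orP[/ends_steps/yu yv|/ca/za//].
  exact: connected_trans zy yv.
- by move=> v /=; rewrite inE => /predU1P[->//|/ma/za].
Qed.

Definition two_sided (m : bitseq) := (true \in m) && (false \in m).

(** Follow a walk from the new point [y] to [x] until it first meets the
    branching, on the trunk or on one of the two bunches.  Empty bunches cannot
    be hit, which is why one-sided masks are allowed in that case only. *)
Lemma branching_insert H x s m z p a b y :
  branching H x s m z p a b -> s != [::] ->
  (two_sided m \/ (a = [::] /\ b = [::])) -> connected_in H x y ->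
  exists m' z' p' a' b',
    branching H x (y :: s) m' z' p' a' b' /\ two_sided m'.
Proof.
move=> br s0 m2 /connected_sym[q0 [Hq0 q0x]].
pose W := [pred v | (v \in x :: p) || (v \in ends a) || (v \in ends b)].
have Wx : W (last y q0) by rewrite q0x /= inE eqxx.
have [q [Hq Wq qW]] := first_hit Hq0 Wx.
have disj c : c \in [:: steps x p; a; b] ->
    edge_disjoint (graph_of (steps y q)) (graph_of c).
  rewrite !inE => /or3P[] /eqP ->; apply: qW => v /=.
  - by move=> /ends_steps; rewrite !inE => ->.
  - by rewrite !inE => ->; rewrite orbT.
  - by rewrite !inE => ->; rewrite !orbT.
have m2' : (exists v, v \in ends a ++ ends b) -> two_sided m.
  by case: m2 => // -[-> ->] [].
have {}m2' v : (v \in ends a) || (v \in ends b) -> two_sided m.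
  by rewrite -mem_cat => ?; apply: m2'; exists v.
case/orP: Wq => [/orP[hit|hit]|hit].
- have [p' [a' br']] := branching_trunk br Hq hit disj.
  exists (false :: nseq (size s) true), (last y q), p', a', (steps y q).
  by split=> //; case: s s0 {br br'} => // ? ? _; rewrite /two_sided !inE.
- exists (true :: m), z, p, (steps y q ++ a), b.
  split; first exact: branching_bunch.
  by have /andP[? fm] := m2' _ ltac:(apply/orP; left; exact: hit); rewrite /two_sided !inE fm.
- exists (flip (true :: flip m)), z, p, a, (steps y q ++ b); split.
    apply: branching_flip; apply: branching_bunch => //.
      exact: branching_flip.
    by move=> c cin; apply: disj; move: cin; rewrite !inE [in X in _ || X]orbC.
  have /andP[tm _] := m2' _ ltac:(apply/orP; right; exact: hit).
  by rewrite /two_sided /= -/(flip _) flipK !inE tm.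
Qed.

(** The points are inserted one at a time; a single point is its own branch
    point, with a simple path as trunk and two empty bunches. *)
Lemma branching_exists H x s : (1 < size s)%N -> all_connected s x H ->
  exists m z p a b, branching H x s m z p a b /\ two_sided m.
Proof.
case: s => // y s; elim: s y => // y1 s IH y _ Hs.
have [xy Hs'] : connected_in H x y /\ all_connected (y1 :: s) x H.
  by split=> [|v vs]; apply: Hs; rewrite inE ?eqxx// vs orbT.
case: s IH Hs' {Hs} => [|y2 s] IH Hs'; last first.
  have [m [z [p [a [b [br m2]]]]]] := IH y1 isT Hs'.
  by apply: branching_insert br _ _ xy => //; left.
have [p0 [Hp0 lp0]] := Hs' y1 (mem_head _ _).
have [p [Hp up lp]] : exists p, [/\ path (adj H) x p, uniq (x :: p) & last x p = y1].
  by move: lp0; case/shortenP: Hp0 => p Hp up _ lp; exists p.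
have br : branching H x [:: y1] [:: true] y1 p [::] [::].
  split=> //; try by move=> ? ?; rewrite /= /list_adj /= !andbF.
  by move=> v; rewrite mem_seq1 => /eqP ->; exact: connected_refl.
by apply: branching_insert br _ _ xy => //; right.
Qed.

(** The trunk witnesses the connection of [x] to the branch point, each bunch
    that of the branch point to its points; the disjoint occurrences are nested
    because BK deals with two events at a time. *)
Lemma branching_occurrence H x s : (1 < size s)%N -> all_connected s x H ->
  exists m z, [/\ size m = size s, two_sided m &
    disjoint_occurrence (all_connected [:: z] x)
      (disjoint_occurrence (all_connected (mask m s) z)
        (all_connected (mask (flip m) s) z)) H].
Proof.
move=> s1 /(branching_exists s1)[m [z [p [a [b [br m2]]]]]].
case: br => [sm Hp up lp Ha Hb pa pb ab ca cb ma mb].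
exists m, z; split=> //.
exists (graph_of (steps x p)), (graph_of (a ++ b)); split; split.
- exact: finite_graph_of.
- exact: finite_graph_of.
- by apply: subgraph_graph_of; rewrite edges_in_steps.
- by apply: subgraph_graph_of; rewrite edges_in_cat Ha.
- by apply: edge_disjointC; apply: edge_disjoint_catl; exact: edge_disjointC.
- move=> H' pH' v; rewrite inE => /eqP ->; apply: connected_mono pH' _.
  by apply: connected_steps Hp _; rewrite -lp mem_last.
move=> H' abH'; exists (graph_of a), (graph_of b); split; split=> //.
- exact: finite_graph_of.
- exact: finite_graph_of.
- by apply: subgraph_trans abH'; exact: subgraph_catl.
- by apply: subgraph_trans abH'; exact: subgraph_catr.
- by move=> H'' aH'' v /ma; exact: connected_mono.
- by move=> H'' bH'' v /mb; exact: connected_mono.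
Qed.

End Branching.

(** * The tree-graph inequality *)

Section LocalEvents.
Variable V : eqType.
Implicit Types (H A B : graph V) (E F : set (graph V)) (a b : seq (V * V)).

(** A common source of the increasing, measurable events to which BK applies:
    connection events are of this kind, and disjoint occurrences always are. *)
Definition local_event E := forall H, E H ->
  exists a, edges_in H a /\ forall H', edges_in H' a -> E H'.

Lemma edges_in_sub A B a : subgraph A B -> edges_in A a -> edges_in B a.
Proof. by move=> AB /allP aA; apply/allP => e /aA /AB. Qed.

Lemma local_increasing E : local_event E -> increasing_event E.
Proof.
move=> lE A AE B AB _ /= ->; have [a [Aa aE]] := lE A (AE A erefl).
by apply: aE; exact: edges_in_sub Aa.
Qed.

Lemma finite_graph_edges A : finite_graph A ->
  exists2 a, edges_in A a & forall H, edges_in H a -> subgraph A H.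
Proof.
move=> /finite_seqP[a aE]; exists a.
  by apply/allP => e ea; have : [set` a] e by []; rewrite -aE.
move=> H /allP Ha u v uv; suff : (u, v) \in a by move/Ha.
by have : [set e | adj A e.1 e.2] (u, v) by []; rewrite aE.
Qed.

Lemma local_disjoint_occurrence E F : local_event (disjoint_occurrence E F).
Proof.
move=> H [A [B [[fA fB AH BH] [dAB wA wB]]]].
have [a Aa aA] := finite_graph_edges fA; have [b Bb bB] := finite_graph_edges fB.
exists (a ++ b); split.
  by rewrite edges_in_cat (edges_in_sub AH Aa) (edges_in_sub BH Bb).
move=> H'; rewrite edges_in_cat => /andP[/aA AH' /bB BH'].
by exists A, B.
Qed.

Lemma local_all_connected s x : local_event (all_connected s x).
Proof.
elim: s => [|y s IH] H Hs; first by exists [::]; split=> // H' _ y; rewrite in_nil.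
have [p [Hp lp]] := Hs y (mem_head _ _).
have [a [Ha aE]] : exists a, edges_in H a /\
    forall H', edges_in H' a -> all_connected s x H'.
  by apply: IH => v vs; apply: Hs; rewrite inE vs orbT.
exists (steps x p ++ a); split; first by rewrite edges_in_cat edges_in_steps Hp.
move=> H'; rewrite edges_in_cat edges_in_steps => /andP[Hp' /aE H's] v.
by rewrite inE => /predU1P[->|/H's//]; exists p.
Qed.

Context (V_countable : countable [set: V]).

(** Such an event is the union, over the countably many finite lists of edges
    that force it, of the events that all the edges of the list are present. *)
Lemma local_preimage X (M : set (set X)) (G : X -> graph V) E :
  sigma_algebra setT M -> (forall e : V * V, M [set w | adj (G w) e.1 e.2]) ->
  local_event E -> M (G @^-1` E).
Proof.
move=> Msig Medge lE.
have [M0 _ Mcup] := Msig.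
have [MT _ _ MI] : [/\ M setT, setSD_closed M, ndseq_closed M & setI_closed M].
  by apply/(@sigma_algebraP _ setT).
have Medges a : M [set w | edges_in (G w) a].
  elim: a => [|e a IH]; first by rewrite (_ : [set _ | _] = setT)//; apply/seteqP.
  rewrite (_ : [set _ | _] = [set w | adj (G w) e.1 e.2] `&`
    [set w | edges_in (G w) a]); first exact: MI.
  by apply/seteqP; split=> w /=; [move=> /andP[]|move=> [-> ->]].
have /countable_injP[g ginj] := V_countable.
pose f a := pickle [seq (g e.1, g e.2) | e <- a].
have finj : injective f.
  move=> a b /(pcan_inj pickleK); apply: inj_map => -[u v] [u' v'] [] ? ?.
  by congr pair; apply: ginj => //; rewrite inE.
pose Q a := forall H, edges_in H a -> E H.
pose U n := \bigcup_(a in [set a | f a = n /\ Q a]) [set w | edges_in (G w) a].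
have -> : G @^-1` E = \bigcup_n U n.
  apply/seteqP; split=> [w /lE[a [Ga aE]]|w [n _ [a [_ Qa]]]].
    by exists (f a) => //; exists a.
  exact: Qa.
apply: Mcup => n.
have [[a [fa Qa]]|noa] := pselect (exists a, f a = n /\ Q a).
  rewrite (_ : U n = [set w | edges_in (G w) a]) //.
  apply/seteqP; split=> w; last by exists a.
  by move=> [b [fb _]] /=; rewrite (finj _ _ (etrans fb (esym fa))).
rewrite (_ : U n = set0)//; apply/seteqP; split=> // w [a Qa _].
by apply: noa; exists a.
Qed.

Lemma local_graph_event E : local_event E -> graph_event E.
Proof.
move=> lE; rewrite /graph_event -[E]/(id @^-1` E).
apply: local_preimage lE; first exact: smallest_sigma_algebra.
by move=> e; apply: sub_sigma_algebra; exists e.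
Qed.

End LocalEvents.

Section TreeGraph.
Context {disp : measure_display} {T : measurableType disp} {R : realType}.
Context (V : choiceType) (P : probability T R) (G : T -> graph V).
Context (V_countable : countable [set: V]).
Context (G_random : random_graph G) (G_BK : BK_inequality P G).
Local Open Scope ereal_scope.

Definition conn_prob (s : seq V) (x : V) : \bar R :=
  P (G @^-1` all_connected s x).

Lemma measurable_local E : local_event E -> measurable (G @^-1` E).
Proof.
by apply: local_preimage => //; exact: sigma_algebra_measurable.
Qed.

Lemma BK_local E F : local_event E -> local_event F ->
  P (G @^-1` disjoint_occurrence E F) <= P (G @^-1` E) * P (G @^-1` F).
Proof.
move=> lE lF; apply: G_BK;
  by [exact: local_graph_event | exact: local_increasing].
Qed.

Definition set_mask n (A : {set 'I_n}) : bitseq := [seq i \in A | i <- enum 'I_n].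

Lemma size_set_mask n (A : {set 'I_n}) : size (set_mask A) = n.
Proof. by rewrite size_map size_enum_ord. Qed.

Lemma count_set_mask n (A : {set 'I_n}) : count id (set_mask A) = #|A|.
Proof.
by rewrite count_map enumT cardE size_filter; apply: eq_count.
Qed.

Lemma set_mask_surj n (m : bitseq) : size m = n ->
  exists A : {set 'I_n}, set_mask A = m.
Proof.
move=> sm; exists [set i : 'I_n | nth false m i]%SET.
apply: (@eq_from_nth _ false); rewrite size_set_mask// => i ltin.
rewrite (nth_map (Ordinal ltin)) ?size_enum_ord// inE.
by rewrite nth_enum_ord.
Qed.

Lemma two_sided_set_mask n (A : {set 'I_n}) :
  two_sided (set_mask A) = (0 < #|A| < n)%N.
Proof.
rewrite -count_set_mask /two_sided; have := size_set_mask A.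
move: (set_mask A) => {A} m <- {n}.
have -> : (true \in m) = (0 < count id m)%N by elim: m => // -[] m.
congr (_ && _); rewrite ltn_neqAle count_size andbT -all_count.
by elim: m => // -[] m /=; rewrite ?inE.
Qed.

(** The tree-graph inequality: the branching decomposition, a union bound over
    the branch point and over the way it splits the points, and BK twice. *)
Lemma tree_graph_inequality n (s : seq V) x : size s = n -> (1 < n)%N ->
  conn_prob s x <=
  \esum_(z in [set: V]) \sum_(A : {set 'I_n} | (0 < #|A| < n)%N)
    conn_prob [:: z] x *
      (conn_prob (mask (set_mask A) s) z * conn_prob (mask (flip (set_mask A)) s) z).
Proof.
move=> <-{n} s1; set n := size s.
pose split_event z (A : {set 'I_n}) := disjoint_occurrence (all_connected [:: z] x)
  (disjoint_occurrence (all_connected (mask (set_mask A) s) z)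
                       (all_connected (mask (flip (set_mask A)) s) z)).
have mD z A : measurable (G @^-1` split_event z A).
  by apply: measurable_local; exact: local_disjoint_occurrence.
have mind (E : set T) : measurable E ->
    measurable_fun [set: T] (fun w => (\1_E w)%:E : \bar R).
  by move=> mE; apply/measurable_EFinP; exact: measurable_indic.
have ind0 (E : set T) w : 0 <= (\1_E w)%:E :> \bar R by rewrite lee_fin indicE.
pose F z w : \bar R := \sum_(A : {set 'I_n} | (0 < #|A| < n)%N)
  (\1_(G @^-1` split_event z A) w)%:E.
have mF z : measurable_fun [set: T] (F z).
  rewrite /F; under eq_fun do rewrite -big_filter.
  by apply: emeasurable_sum => A; exact: mind.
have F0 z w : 0 <= F z w by apply: sume_ge0 => *; exact: ind0.
have mE : measurable (G @^-1` all_connected s x).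
  by apply: measurable_local; exact: local_all_connected.
have -> : conn_prob s x = \int[P]_w (\1_(G @^-1` all_connected s x) w)%:E.
  by rewrite integral_indic// setIT.
apply: (@le_trans _ _ (\int[P]_w (\esum_(z in [set: V]) F z w))).
  apply: ge0_le_integral => //.
  - exact: mind.
  - exact: measurable_esum.
  move=> w _; rewrite indicE; have [Ew|_] := boolP (w \in _); last exact: esum_ge0.
  have [m [z [sm m2 Dw]]] := branching_occurrence s1 (set_mem Ew).
  have [A mA] := set_mask_surj sm.
  apply: le_trans (@ge0_le_esumT _ _ (F ^~ w) z _); last by move=> ?; exact: F0.
  rewrite /F (bigD1 A)/=; last by rewrite -two_sided_set_mask mA.
  rewrite indicE mem_set; last by rewrite /= /split_event mA.
  by rewrite leeDl// sume_ge0.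
rewrite integral_esum//; apply: le_esum => z _; rewrite /F.
under eq_integral do rewrite -big_filter.
rewrite ge0_integral_sum//; last by move=> A; exact: mind.
rewrite big_filter; apply: lee_sum => A _.
rewrite integral_indic// setIT; apply: le_trans (BK_local _ _) _.
- exact: local_all_connected.
- exact: local_disjoint_occurrence.
rewrite lee_wpmul2l//; apply: BK_local; exact: local_all_connected.
Qed.

End TreeGraph.

(** * Kernel estimates *)

Section Sums.
Context {R : realType}.

Lemma esum_nat_le (a : nat -> R) M : (forall n, 0 <= a n) ->
  (forall N, \sum_(0 <= i < N) a i <= M) ->
  (\esum_(n in [set: nat]) (a n)%:E <= M%:E)%E.
Proof.
move=> a0 aM; rewrite -nneseries_esumT; last by move=> n; rewrite lee_fin.
apply: lime_le.
  by apply: is_cvg_nneseries => n _ _; rewrite lee_fin.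
by apply: nearW => N; rewrite sumEFin lee_fin.
Qed.

Lemma geometric_tail_le (rho : R) (k N : nat) : 0 < rho < 1 ->
  \sum_(0 <= i < N | (k <= i)%N) rho ^+ i <= rho ^+ k / (1 - rho).
Proof.
move=> /andP[rho0 rho1].
have rhs0 : 0 <= rho ^+ k / (1 - rho).
  by rewrite divr_ge0 ?exprn_ge0 ?subr_ge0// ltW.
have [leNk|/ltnW lekN] := leqP N k.
  rewrite big_nat_cond big_pred0// => i.
  by apply/negbTE; apply/negP => /andP[/andP[_ iN] ki]; lia.
rewrite (big_cat_nat _ (n := k))//= big_nat_cond big_pred0 ?add0r; last first.
  by move=> i; apply/negbTE; apply/negP => /andP[/andP[_ iN] ki]; lia.
rewrite big_nat_cond (eq_bigl (fun i => (k <= i < N)%N && true)); last first.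
  by move=> i; lia.
rewrite -big_nat_cond -(subnKC lekN) geometric_partial_tail.
by apply: geometric_le_lim; rewrite ?exprn_ge0 ?ltW// gtr0_norm.
Qed.

Lemma geometric_sum_le (q : R) k : 1 < q ->
  \sum_(0 <= j < k.+1) q ^+ j <= q / (q - 1) * q ^+ k.
Proof.
move=> q1; have q10 : 0 < q - 1 by rewrite subr_gt0.
rewrite mulrAC ler_pdivlMr// mulrC big_mkord -subrX1 exprS.
by rewrite lerBlDr lerDl.
Qed.

Lemma esum_dball_le (V : metricType R) (x : V) r :
  (\esum_(z in [set: V]) ((mdist x z <= r)%R%:R)%:E <= counting (dball x r) :> \bar R)%E.
Proof.
rewrite /counting; case: asboolP => [fB|_]; last exact: leey.
rewrite (_ : (\esum_(z in _) _)%E = (\esum_(z in dball x r) 1%:E)%E); last first.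
  rewrite [RHS]esum_mkcond; apply: eq_esum => z _.
  rewrite -[z \in dball x r]/(`[< mdist x z <= r >]) asboolb.
  by case: ifP.
rewrite esum_fset//.
by rewrite fsbig_finite//= sumEFin big_const_seq count_predT iter_addr addr0.
Qed.

End Sums.

Section Kernels.
Context {R : realType} {V : metricType R}.
Implicit Types (alpha beta : R) (x y z : V).

Lemma powR2_ge1 (e : R) : 0 <= e -> 1 <= 2 `^ e :> R.
Proof. by move=> e0; have := ler_powR (ler1n R 2) e0; rewrite powRr0. Qed.

Lemma powR2_gt1 (e : R) : 0 < e -> 1 < 2 `^ e :> R.
Proof.
by move=> e0; rewrite /powR pnatr_eq0/= expR_gt1 mulr_gt0// ln_gt0// ltr1n.
Qed.

Lemma powR2N_lt1 (e : R) : 0 < e -> 2 `^ (- e) < 1 :> R.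
Proof. by move=> e0; rewrite powRN invf_lt1 ?powR_gt0// powR2_gt1. Qed.

Lemma gker_gt0 alpha x y : 0 < gker alpha x y.
Proof. by rewrite invr_gt0 ltr_pwDl// powR_ge0. Qed.

Lemma gker_ge0 alpha x y : 0 <= gker alpha x y.
Proof. exact/ltW/gker_gt0. Qed.

Lemma gkerC alpha x y : gker alpha x y = gker alpha y x.
Proof. by rewrite /gker metric_sym. Qed.

Lemma gker_decr alpha beta x y : 0 <= beta -> beta <= alpha ->
  gker alpha x y <= 2 * gker beta x y.
Proof.
move=> beta0 le_ba; rewrite /gker; set t := mdist x y.
have t0 : 0 <= t by exact: mdist_ge0.
have a0 := powR_ge0 t alpha; have b0 := powR_ge0 t beta.
suff tab : t `^ beta <= 1 + t `^ alpha.
  rewrite -ler_pdivrMl// -invfM lef_pV2 ?posrE; lra.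
have [t1|/ltW t1] := leP t 1; last first.
  by rewrite (le_trans (ler_powR t1 le_ba))// lerDr.
suff : t `^ beta <= 1 by lra.
by have := ge0_ler_powR beta0 (x := t) (y := 1); rewrite !nnegrE powR1; apply.
Qed.

(** One of the two factors sees a distance at least half of [mdist x y], hence
    is comparable to [gker alpha x y]. *)
Lemma gker_three_points alpha x z y : 0 <= alpha ->
  gker alpha x z * gker alpha z y <=
  2 `^ alpha * gker alpha x y * (gker alpha x z + gker alpha z y).
Proof.
move=> al0.
have half (u v : V) : mdist x y <= 2 * mdist u v ->
    gker alpha u v <= 2 `^ alpha * gker alpha x y.
  move=> le_2; rewrite -ler_pdivrMl ?powR_gt0// /gker -invfM.
  have p0 := powR_ge0 (mdist u v) alpha.
  have p1 : 1 <= 2 `^ alpha :> R by exact: powR2_ge1.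
  have : mdist x y `^ alpha <= 2 `^ alpha * mdist u v `^ alpha.
    by rewrite -powRM ?mdist_ge0// ge0_ler_powR// nnegrE ?mulr_ge0 ?mdist_ge0.
  rewrite lef_pV2 ?posrE ?mulr_gt0 ?ltr_pwDl ?powR_ge0 ?powR_gt0//.
  by rewrite mulrDr mulr1 => ?; apply: lerD.
have g1 := gker_ge0 alpha x z; have g2 := gker_ge0 alpha z y.
have g3 := gker_ge0 alpha x y.
have p0 := powR_ge0 (2 : R) alpha.
rewrite mulrDr.
have [le_xz|/ltW le_zy] := leP (mdist x z) (mdist z y).
  rewrite [leLHS]mulrC ler_wpDr ?mulr_ge0// ler_wpM2r// half//.
  by rewrite (le_trans (metric_triangle _ z _))//; lra.
rewrite ler_wpDl ?mulr_ge0// ler_wpM2r// half//.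
by rewrite (le_trans (metric_triangle _ z _))//; lra.
Qed.

Lemma gker_dyadic alpha x y : 0 < alpha -> exists k : nat,
  mdist x y <= 2 ^+ k /\
  gker alpha x y <= 2 `^ alpha * (2 `^ (- alpha)) ^+ k.
Proof.
move=> al0; rewrite /gker; set t := mdist x y.
have t0 : 0 <= t by exact: mdist_ge0.
have ex_k : exists k : nat, t <= 2 ^+ k.
  by exists (Num.bound t); rewrite ltW// upper_nthrootP.
case: (ex_minnP ex_k) => k tk mink; exists k; split => //.
have p0 := powR_ge0 t alpha.
case: k tk mink => [|k] tk mink.
  rewrite expr0 mulr1 (@le_trans _ _ 1)//.
    by rewrite invf_le1 ?lerDl// ltr_pwDl.
  by rewrite powR2_ge1// ltW.
have {mink} kt : 2 ^+ k < t by rewrite ltNge; apply/negP => /mink; rewrite ltnn.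
rewrite exprS mulrA -powRD ?pnatr_eq0 ?implybT// subrr powRr0 mul1r.
rewrite powRN exprVn lef_pV2 ?posrE ?exprn_gt0 ?powR_gt0 ?ltr_pwDl//.
rewrite -[leLHS]powR_mulrn ?powR_ge0// -powRrM mulrC powRrM powR_mulrn//.
rewrite (le_trans (y := t `^ alpha)) ?lerDr//.
by rewrite ge0_ler_powR ?nnegrE ?exprn_ge0// ltW.
Qed.

(** Decompose each distance dyadically: the scale [2 ^ k] of the larger of the
    two distances [mdist x z] and [mdist z y] is at least half of [mdist x y],
    and the sum over the smaller scales [2 ^ j] is dominated by [j = k] as
    [alpha < d]; the resulting terms decay geometrically in [k], as
    [d < 2 * alpha]. *)
Lemma gker_convolution (d alpha : R) : polynomial_volume_growth V d ->
  0 < alpha -> d / 2 < alpha -> alpha < d -> exists2 C : R, 0 < C &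
    forall x y, (\esum_(z in [set: V]) (gker alpha x z * gker alpha z y)%:E <=
                 (C * gker (2 * alpha - d) x y)%:E)%E.
Proof.
move=> [c1 [c2 [c1_gt0 c2_gt0 growth]]] al0 al_gt al_lt.
pose a : R := 2 `^ alpha; pose w : R := 2 `^ (- alpha); pose D : R := 2 `^ d.
pose q := w * D; pose rho := w * q.
have [a0 w0 D0] : [/\ 0 < a, 0 < w & 0 < D] by rewrite !powR_gt0.
have a0l := ltW a0; have w0l := ltW w0; have D0l := ltW D0.
have two_gt1 : 1 < 2 :> R by rewrite ltr1n.
have qE : q = 2 `^ (d - alpha).
  by rewrite /q /w /D -powRD ?pnatr_eq0 ?implybT// addrC.
have rhoE : rho = 2 `^ (- (2 * alpha - d)).
  rewrite /rho qE /w -powRD ?pnatr_eq0 ?implybT//; congr powR; lra.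
have q1 : 1 < q by rewrite qE powR2_gt1// subr_gt0.
have rho01 : 0 < rho < 1.
  by rewrite rhoE powR_gt0// powR2N_lt1//; lra.
have /andP[rho0 rho1] := rho01.
(* [t x y z k] collects the pairs of scales [j <= k] for [mdist x z] and
   [mdist z y]; by the triangle inequality [mdist x y] is at most twice the
   larger scale, whence the indicator *)
pose t x y z (k : nat) : R := (mdist x y <= 2 ^+ k.+1)%R%:R *
  (w ^+ k * \sum_(0 <= j < k.+1) w ^+ j * (mdist x z <= 2 ^+ j)%R%:R).
have t_ge0 x y z k : 0 <= t x y z k.
  rewrite !mulr_ge0 ?exprn_ge0 ?sumr_ge0//// => j _.
  by rewrite mulr_ge0 ?exprn_ge0.
have dominated x y z j k : (j <= k)%N -> mdist x z <= 2 ^+ j ->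
    mdist z y <= 2 ^+ k -> w ^+ j * w ^+ k <= t x y z k.
  move=> jk xz zy; rewrite /t.
  have -> : mdist x y <= 2 ^+ k.+1.
    rewrite (le_trans (metric_triangle _ z _))// exprS.
    have : 2 ^+ j <= 2 ^+ k :> R by rewrite ler_weXn2l// ler1n.
    lra.
  rewrite mul1r [leLHS]mulrC ler_wpM2l ?exprn_ge0// big_mkord.
  rewrite (bigD1 (Ordinal (_ : (j < k.+1)%N)))//= xz mulr1 lerDl sumr_ge0// => i _.
  by rewrite mulr_ge0 ?exprn_ge0.
pose S x y z : \bar R := (\esum_(k in [set: nat]) (t x y z k)%:E)%E.
have S_ge0 x y z : (0 <= S x y z)%E by apply: esum_ge0 => k _; rewrite lee_fin.
have pointwise x y z :
    ((gker alpha x z * gker alpha z y)%:E <= (a * a)%:E * (S x y z + S y x z))%E.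
  have [j [xz gj]] := gker_dyadic x z al0; have [k [zy gk]] := gker_dyadic z y al0.
  rewrite (@le_trans _ _ ((a * a)%:E * (w ^+ j * w ^+ k)%:E)%E)//.
    by rewrite -EFinM lee_fin mulrACA ler_pM// gker_ge0.
  rewrite lee_wpmul2l ?lee_fin ?mulr_ge0//.
  have [jk|/ltnW kj] := leqP j k.
    rewrite (@le_trans _ _ (S x y z))// ?leeDl//.
    rewrite (le_trans _ (ge0_le_esumT k _))// ?lee_fin; last by move=> i; rewrite lee_fin.
    exact: dominated.
  rewrite (@le_trans _ _ (S y x z))// ?leeDr//.
  rewrite (le_trans _ (ge0_le_esumT j _))// ?lee_fin; last by move=> i; rewrite lee_fin.
  by rewrite mulrC; apply: dominated; rewrite // metric_sym.
pose M := c2 * (q / (q - 1)) / (1 - rho) * (1 + 2 `^ (2 * alpha - d)).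
have M0 : 0 < M by rewrite !mulr_gt0 ?invr_gt0 ?subr_gt0 ?ltr_pwDl ?powR_ge0//; lra.
have sumS x y : (\esum_(z in [set: V]) S x y z <=
    (M * gker (2 * alpha - d) x y)%:E)%E.
  rewrite esum_swap; last by move=> *; rewrite lee_fin.
  have ex_k : exists k : nat, mdist x y <= 2 ^+ k.+1.
    exists (Num.bound (mdist x y)).
    rewrite (le_trans (ltW (upper_nthrootP (leqnn _))))//.
    by rewrite ler_weXn2l// ler1n.
  (* only the scales above the least one, [k0], compatible with [mdist x y]
     contribute, and [rho ^+ k0] is comparable to [gker (2 * alpha - d) x y] *)
  case: (ex_minnP ex_k) => k0 xyk0 mink0.
  apply: (@le_trans _ _ (\esum_(k in [set: nat])
      ((k0 <= k)%N%:R * (c2 * (q / (q - 1)) * rho ^+ k))%:E)%E).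
    apply: le_esum => k _; rewrite /t.
    under eq_esum do rewrite EFinM.
    rewrite esumZl; last 2 first.
      by rewrite lee_fin.
      by move=> z; rewrite lee_fin mulr_ge0 ?exprn_ge0 ?sumr_ge0//// => j _;
        rewrite mulr_ge0 ?exprn_ge0.
    have [xyk|_] := leP (mdist x y) (2 ^+ k.+1); last first.
      by rewrite mul0e lee_fin !mulr_ge0// ?invr_ge0 ?exprn_ge0//; lra.
    rewrite (mink0 _ xyk) mul1e mul1r.
    under eq_esum do rewrite EFinM.
    rewrite esumZl; last 2 first.
      by rewrite lee_fin exprn_ge0.
      by move=> z; rewrite lee_fin sumr_ge0// => j _; rewrite mulr_ge0 ?exprn_ge0.
    under eq_esum do rewrite -sumEFin.
    rewrite esum_sum; last first.
      by move=> *; rewrite lee_fin mulr_ge0 ?exprn_ge0.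
    apply: (@le_trans _ _ ((w ^+ k)%:E *
        (\sum_(0 <= j < k.+1) (c2 * q ^+ j))%:E)%E).
      rewrite lee_wpmul2l ?lee_fin ?exprn_ge0// -sumEFin.
      apply: lee_sum => j _.
      under eq_esum do rewrite EFinM.
      rewrite esumZl; last 2 first.
        by rewrite lee_fin exprn_ge0.
        by move=> z; rewrite lee_fin.
      have -> : c2 * q ^+ j = w ^+ j * (c2 * (2 ^+ j) `^ d).
        rewrite exprMn -[in (2 ^+ j) `^ d]powR_mulrn// -powRrM mulrC.
        by rewrite [j%:R * d]mulrC powRrM powR_mulrn ?powR_ge0// -/D [c2 * _]mulrC mulrA.
      rewrite EFinM lee_wpmul2l ?lee_fin ?exprn_ge0//.
      apply: (le_trans (esum_dball_le _ _)).
      have /(growth x)[_ //] : 1 <= 2 ^+ j :> R by rewrite exprn_ege1// ler1n.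
    rewrite -EFinM lee_fin -mulr_sumr mulrCA -[leRHS]mulrA ler_pM2l//.
    rewrite /rho exprMn [leRHS]mulrCA ler_pM2l ?exprn_gt0//.
    exact: geometric_sum_le.
  apply: esum_nat_le => [k|N].
    by rewrite !mulr_ge0// ?invr_ge0 ?exprn_ge0//; lra.
  have -> : \sum_(0 <= i < N) (k0 <= i)%N%:R * (c2 * (q / (q - 1)) * rho ^+ i) =
      c2 * (q / (q - 1)) * \sum_(0 <= i < N | (k0 <= i)%N) rho ^+ i.
    rewrite [in RHS]big_mkcond/= mulr_sumr; apply: eq_bigr => i _.
    by case: leqP => _; rewrite ?mul1r// mul0r mulr0.
  have q0 : 0 < q by rewrite (lt_trans _ q1).
  rewrite /M -!mulrA !ler_pM2l ?invr_gt0 ?subr_gt0//.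
  apply: (le_trans (geometric_tail_le _ _ rho01)).
  rewrite [leLHS]mulrC ler_pM2l ?invr_gt0 ?subr_gt0//.
  rewrite rhoE powRN exprVn /gker ler_pdivlMr ?ltr_pwDl ?powR_ge0//.
  rewrite ler_pdivrMl ?exprn_gt0 ?powR_gt0//.
  have P1 : 1 <= (2 `^ (2 * alpha - d)) ^+ k0 :> R.
    by rewrite exprn_ege1// powR2_ge1//; lra.
  rewrite mulrDr mulr1 lerD//.
  apply: (@le_trans _ _ ((2 ^+ k0.+1) `^ (2 * alpha - d))).
    by rewrite ge0_ler_powR ?nnegrE ?mdist_ge0 ?exprn_ge0//; lra.
  rewrite -[in (2 ^+ k0.+1) `^ _]powR_mulrn// -powRrM mulrC powRrM.
  by rewrite powR_mulrn ?powR_ge0// exprSr.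
exists (a * a * (M + M)); first by rewrite !mulr_gt0// addr_gt0.
move=> x y.
apply: (le_trans (le_esum (fun z _ => pointwise x y z))).
rewrite esumZl; last 2 first.
  by rewrite lee_fin mulr_ge0.
  by move=> z; rewrite adde_ge0.
rewrite esumD// -mulrA [leRHS]EFinM lee_wpmul2l ?lee_fin ?mulr_ge0//.
rewrite mulrDl EFinD leeD//.
by rewrite gkerC.
Qed.

End Kernels.

Section Potential.
Context {R : realType} {V : metricType R}.
Local Open Scope ereal_scope.

(** Squaring the potential [h] of [phi] and applying the kernel again gives back
    a multiple of [h]: this closes the recursion over branch points.  After
    [gker_three_points], the factor [gker alpha x y] comes out of the sum over
    [z], and the remaining sum is controlled by [gker_convolution]. *)
Lemma potential_bounds (d alpha : R) : polynomial_volume_growth V d ->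
  (0 < alpha)%R -> (d / 2 < alpha)%R -> (alpha < d)%R -> exists2 K : R, (1 <= K)%R &
  forall phi : V -> R, (forall y, 0 <= phi y)%R ->
    (forall x, kconv (gker (2 * alpha - d)) phi x <= 1) ->
    let h := kconv (gker alpha) phi in
    (forall x, h x <= 2%:E) /\
    (forall x, \esum_(z in [set: V]) ((gker alpha x z)%:E * (h z * h z)) <=
       K%:E * h x).
Proof.
move=> V_growth alpha_gt0 alpha_gt alpha_lt.
have [C2 C20 conv] := gker_convolution V_growth alpha_gt0 alpha_gt alpha_lt.
have beta_ge0 : (0 <= 2 * alpha - d)%R by lra.
have beta_le : (2 * alpha - d <= alpha)%R by lra.
have C2l := ltW C20.
pose K := (2 `^ alpha * (C2 + C2))%R.
have K0 : (0 <= K)%R by rewrite mulr_ge0 ?powR_ge0// addr_ge0.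
exists (1 + K)%R; first by rewrite lerDl.
move=> phi phi0 phi_le1 h.
have g0 x z : (0 <= gker alpha x z)%R by exact: gker_ge0.
have gE0 x z : 0 <= (gker alpha x z)%:E :> \bar R by rewrite lee_fin.
have gphi0 x y : 0 <= (gker alpha x y * phi y)%:E :> \bar R.
  by rewrite lee_fin mulr_ge0.
have h0 x : 0 <= h x by apply: esum_ge0.
(* the convolution of the kernel with its own potential is bounded *)
have gh x : \esum_(z in [set: V]) ((gker alpha x z)%:E * h z) <= C2%:E.
  under eq_esum do rewrite -esumZl//.
  rewrite esum_swap; last by move=> *; rewrite mule_ge0.
  apply: (@le_trans _ _ (\esum_(y in [set: V])
      ((C2 * (gker (2 * alpha - d) x y * phi y))%:E))).
    apply: le_esum => y _.
    under eq_esum do rewrite -EFinM mulrA EFinM.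
    rewrite esumZr ?lee_fin//; last by move=> z; rewrite lee_fin mulr_ge0.
    by rewrite mulrA EFinM lee_wpmul2r// lee_fin.
  under eq_esum do rewrite EFinM.
  rewrite esumZl ?lee_fin//; last by move=> y; rewrite lee_fin mulr_ge0// gker_ge0.
  by rewrite -[leRHS]mule1 lee_wpmul2l ?lee_fin//; exact: phi_le1.
split=> x.
  apply: (@le_trans _ _ (2%:E * kconv (gker (2 * alpha - d)) phi x)); last first.
    by rewrite -[leRHS]mule1 lee_wpmul2l.
  rewrite /kconv -esumZl//; last by move=> y; rewrite lee_fin mulr_ge0// gker_ge0.
  apply: le_esum => y _; rewrite -EFinM lee_fin mulrA ler_wpM2r//.
  exact: gker_decr.
have term0 z y : 0 <= (2 `^ alpha * (gker alpha x y * phi y))%:E *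
    ((gker alpha x z)%:E * h z + (gker alpha y z)%:E * h z).
  by rewrite mule_ge0 ?adde_ge0 ?mule_ge0// lee_fin mulr_ge0 ?powR_ge0 ?mulr_ge0.
apply: (@le_trans _ _ (\esum_(z in [set: V]) \esum_(y in [set: V])
    ((2 `^ alpha * (gker alpha x y * phi y))%:E *
     ((gker alpha x z)%:E * h z + (gker alpha y z)%:E * h z)))).
  apply: le_esum => z _; rewrite muleA.
  have gxhE : (gker alpha x z)%:E * h z =
      \esum_(y in [set: V]) ((gker alpha x z)%:E * (gker alpha z y * phi y)%:E).
    by rewrite esumZl.
  rewrite [X in X * h z <= _]gxhE -esumZr//; last by move=> y; rewrite mule_ge0.
  apply: le_esum => y _.
  rewrite -ge0_muleDl// muleA lee_wpmul2r// -EFinD -!EFinM lee_fin.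
  rewrite !mulrA [leRHS]mulrAC ler_wpM2r//.
  by rewrite (gkerC _ y z) gker_three_points// ltW.
rewrite esum_swap//.
apply: (@le_trans _ _ (\esum_(y in [set: V])
    ((2 `^ alpha * (gker alpha x y * phi y))%:E * (C2 + C2)%:E))).
  apply: le_esum => y _.
  rewrite esumZl; last 2 first.
    by rewrite lee_fin mulr_ge0 ?powR_ge0 ?mulr_ge0.
    by move=> z; rewrite adde_ge0 ?mule_ge0.
  rewrite lee_wpmul2l//; first by rewrite lee_fin mulr_ge0 ?powR_ge0 ?mulr_ge0.
  by rewrite esumD; [rewrite EFinD leeD|move=> *; exact: mule_ge0..].
apply: (@le_trans _ _ (K%:E * h x)); last by rewrite lee_wpmul2r// lee_fin lerDr.
rewrite /h /kconv -esumZl//.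
by apply: le_esum => y _; rewrite -!EFinM lee_fin /K mulrAC.
Qed.

End Potential.

(** * Iterated sums over sequences of points *)

Section IteratedSums.
Context {R : realType} {V : choiceType} (phi : V -> R).
Context (phi_ge0 : forall y, 0 <= phi y).
Local Open Scope ereal_scope.
Implicit Types (F : seq V -> \bar R) (n : nat).

Fixpoint itersum n F : \bar R :=
  if n is n'.+1 then
    \esum_(y in [set: V]) ((phi y)%:E * itersum n' (fun s => F (y :: s)))
  else F [::].

Let phiE0 y : 0 <= (phi y)%:E :> \bar R. Proof. by rewrite lee_fin. Qed.

Lemma itersum_ge0 n F : (forall s, 0 <= F s) -> 0 <= itersum n F.
Proof.
elim: n F => //= n IH F F0; apply: esum_ge0 => y _.
by rewrite mule_ge0// IH.
Qed.

Lemma le_itersum n F F' : (forall s, size s = n -> F s <= F' s) ->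
  itersum n F <= itersum n F'.
Proof.
elim: n F F' => [|n IH] F F' FF' /=; first exact: FF'.
apply: le_esum => y _; rewrite lee_wpmul2l// IH// => s sn.
by apply: FF'; rewrite /= sn.
Qed.

Lemma eq_itersum n F F' : F =1 F' -> itersum n F = itersum n F'.
Proof. by move=> /funext ->. Qed.

Lemma itersumZl n F c : 0 <= c -> (forall s, 0 <= F s) ->
  itersum n (fun s => c * F s) = c * itersum n F.
Proof.
move=> c0; elim: n F => //= n IH F F0.
rewrite -esumZl//; last by move=> y; rewrite mule_ge0// itersum_ge0.
by apply: eq_esum => y _; rewrite IH// muleCA.
Qed.

Lemma itersum_esum n (I : choiceType) (F : I -> seq V -> \bar R) :
  (forall i s, 0 <= F i s) ->
  itersum n (fun s => \esum_(i in [set: I]) F i s) =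
  \esum_(i in [set: I]) itersum n (F i).
Proof.
elim: n F => //= n IH F F0.
rewrite [RHS]esum_swap; last by move=> *; rewrite mule_ge0// itersum_ge0.
apply: eq_esum => y _; rewrite IH// esumZl// => i.
by rewrite itersum_ge0.
Qed.

Lemma itersum_sum n (I : choiceType) (r : seq I) (P : pred I) (F : I -> seq V -> \bar R) :
  (forall i s, 0 <= F i s) ->
  itersum n (fun s => \sum_(i <- r | P i) F i s) =
  \sum_(i <- r | P i) itersum n (F i).
Proof.
elim: n F => //= n IH F F0.
rewrite -esum_sum; last by move=> *; rewrite mule_ge0// itersum_ge0.
apply: eq_esum => y _; rewrite IH// ge0_sume_distrr// => i _.
by rewrite itersum_ge0.
Qed.

(** Each point of the sequence is seen by exactly one of the two factors, so
    that the sums decouple. *)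
Lemma itersum_mask (m : bitseq) F F' :
  (forall s, 0 <= F s) -> (forall s, 0 <= F' s) ->
  itersum (size m) (fun s => F (mask m s) * F' (mask (flip m) s)) =
  itersum (count id m) F * itersum (count negb m) F'.
Proof.
elim: m F F' => //= -[] m IH F F' F0 F'0 /=.
  rewrite !add0n -esumZr ?itersum_ge0//; last first.
    by move=> y; rewrite mule_ge0// itersum_ge0.
  apply: eq_esum => y _.
  by rewrite (IH (fun s => F (y :: s)))// muleA.
rewrite !add0n -esumZl ?itersum_ge0//; last first.
  by move=> y; rewrite mule_ge0// itersum_ge0.
apply: eq_esum => y _.
by rewrite (IH F (fun s => F' (y :: s)))// muleCA.
Qed.

End IteratedSums.

(** * Moments of the weighted cluster size *)

Section RealSums.
Context {R : realType}.

Lemma sum_subsets_card n (f : nat -> R) :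
  \sum_(A : {set 'I_n} | (0 < #|A| < n)%N) f #|A| =
  \sum_(1 <= k < n) 'C(n, k)%:R * f k.
Proof.
rewrite big_mkcond /=.
under eq_bigr do rewrite -(big_nat1_eq +%R f).
rewrite (exchange_big_dep xpredT)//=; apply: eq_bigr => k _.
rewrite (eq_bigl [in [set A : {set 'I_n} | #|A| == k]%SET]); last first.
  by move=> A; rewrite !inE eq_sym.
by rewrite sumr_const card_draws card_ord mulr_natl.
Qed.

(** By telescoping, since [1 / (n + 1) ^ 2 <= 1 / n - 1 / (n + 1)]. *)
Lemma sum_inv_sqr_le n : (0 < n)%N ->
  \sum_(1 <= k < n.+1) (k%:R ^+ 2)^-1 <= 2 - n%:R^-1 :> R.
Proof.
elim: n => // -[_ _|n /(_ isT) IH _]; first by rewrite big_nat1 expr1n invr1; lra.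
rewrite big_nat_recr//= (le_trans (lerD IH (lexx _)))//.
have n1 : 0 < n.+1%:R :> R by rewrite ltr0n.
have n2 : 0 < n.+2%:R :> R by rewrite ltr0n.
have xu : n.+1%:R * n.+1%:R^-1 = 1 :> R by rewrite divff// lt0r_neq0.
have yv : (n.+1%:R + 1) * n.+2%:R^-1 = 1 :> R.
  by rewrite natr1 divff// lt0r_neq0.
have vu : n.+2%:R^-1 <= n.+1%:R^-1 :> R by rewrite lef_pV2 ?posrE// ler_nat.
have v0 : 0 <= n.+2%:R^-1 :> R by rewrite invr_ge0.
rewrite -exprVn; move: xu yv vu v0.
move: (n.+1%:R : R) (n.+1%:R^-1 : R) (n.+2%:R^-1 : R) => x u v xu xv vu v0.
have uvE : u * v = u - v.
  have : (x * u) * v = v by rewrite xu mul1r.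
  have : ((x + 1) * v) * u = u by rewrite xv mul1r.
  lra.
nra.
Qed.

(** From [1 / (k (n - k)) = (1 / k + 1 / (n - k)) / n] and the convergence of the
    sum of the inverse squares. *)
Lemma conv_inv_sqr_le n : (0 < n)%N ->
  \sum_(1 <= k < n) (k%:R ^+ 2)^-1 * ((n - k)%:R ^+ 2)^-1 <= 8 / n%:R ^+ 2 :> R.
Proof.
case: n => // n _.
pose a k : R := (k%:R ^+ 2)^-1.
have rev : \sum_(1 <= k < n.+1) a (n.+1 - k)%N = \sum_(1 <= k < n.+1) a k.
  by rewrite [RHS]big_nat_rev/=; apply: eq_bigr => k _; rewrite add1n subSS.
have sum_a : \sum_(1 <= k < n.+1) a k <= 2.
  case: n {rev} => [|n]; first by rewrite big_geq.
  by rewrite (le_trans (sum_inv_sqr_le _))// gerBl invr_ge0.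
apply: (@le_trans _ _ (\sum_(1 <= k < n.+1)
    (2 / n.+1%:R ^+ 2 * a k + 2 / n.+1%:R ^+ 2 * a (n.+1 - k)%N))).
  rewrite !big_nat; apply: ler_sum => k /andP[k1 kn].
  rewrite /a natrB; last by rewrite ltnW.
  have : 0 < k%:R :> R by rewrite ltr0n.
  have : k%:R < n.+1%:R :> R by rewrite ltr_nat.
  rewrite -!exprVn; move: (k%:R : R) (n.+1%:R : R) => x y xy x0.
  have xp : x * x^-1 = 1 by rewrite divff// lt0r_neq0.
  have yr : y * y^-1 = 1 by rewrite divff// lt0r_neq0// (lt_trans x0).
  have yxq : (y - x) * (y - x)^-1 = 1 by rewrite divff// lt0r_neq0// subr_gt0.
  move: (x^-1) (y^-1) ((y - x)^-1) xp yr yxq => p r q xp yr yxq.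
  (* with p = 1/x, q = 1/(y - x) and r = 1/y, the product p q is r (p + q) *)
  have pqE : p * q = r * (p + q).
    have h1 : ((y - x) * q) * (p * r) = p * r by rewrite yxq mul1r.
    have h2 : (x * p) * (q * r) = q * r by rewrite xp mul1r.
    have h3 : (y * r) * (p * q) = p * q by rewrite yr mul1r.
    lra.
  have -> : p ^+ 2 * q ^+ 2 = r ^+ 2 * (p + q) ^+ 2 by rewrite -!exprMn pqE.
  have -> : 2 * r ^+ 2 * p ^+ 2 + 2 * r ^+ 2 * q ^+ 2 =
      r ^+ 2 * (2 * (p ^+ 2 + q ^+ 2)) by lra.
  rewrite ler_wpM2l ?sqr_ge0//.
  by have := sqr_ge0 (p - q); lra.
rewrite big_split/= -!mulr_sumr rev -mulrDr.
have : 0 <= 2 / n.+1%:R ^+ 2 :> R by rewrite divr_ge0.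
have -> : 8 / n.+1%:R ^+ 2 = 2 / n.+1%:R ^+ 2 * 4 :> R by rewrite mulrAC -natrM.
by move=> c0; rewrite ler_wpM2l//; lra.
Qed.

Definition weight (B L : R) n := B * L ^+ n / n%:R ^+ 2.

Lemma weight_ge0 B L n : 0 <= B -> 0 <= L -> 0 <= weight B L n.
Proof. by move=> B0 L0; rewrite divr_ge0 ?exprn_ge0// mulr_ge0// exprn_ge0. Qed.

(** The inverse square makes geometric sequences stable under convolution up to
    a constant, so that they dominate the solutions of Catalan-like recursions
    without any count of binary trees. *)
Lemma conv_weights_le (B L : R) n : 0 <= B -> 0 <= L ->
  \sum_(1 <= k < n) weight B L k * weight B L (n - k) <= 8 * B * weight B L n.
Proof.
move=> B0 L0; have [->|n0] := posnP n.
  by rewrite big_geq// mulr_ge0 ?weight_ge0// mulr_ge0.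
have -> : \sum_(1 <= k < n) weight B L k * weight B L (n - k) = B ^+ 2 * L ^+ n *
    \sum_(1 <= k < n) (k%:R ^+ 2)^-1 * ((n - k)%:R ^+ 2)^-1.
  rewrite mulr_sumr !big_nat; apply: eq_bigr => k /andP[_ kn]; rewrite /weight.
  have -> : L ^+ n = L ^+ k * L ^+ (n - k) by rewrite -exprD subnKC// ltnW.
  move: (L ^+ k) (L ^+ (n - k)) (k%:R ^- 2 : R) ((n - k)%:R ^- 2 : R).
  by move=> l1 l2 i1 i2; lra.
have -> : 8 * B * weight B L n = B ^+ 2 * L ^+ n * (8 / n%:R ^+ 2).
  by rewrite /weight; move: (L ^+ n) (n%:R ^- 2 : R) => l i; lra.
by rewrite ler_wpM2l ?conv_inv_sqr_le// mulr_ge0 ?exprn_ge0.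
Qed.

End RealSums.

Section Moments.
Context {disp : measure_display} {T : measurableType disp} {R : realType}.
Context (V : choiceType) (P : probability T R) (G : T -> graph V).
Context (V_countable : countable [set: V]).
Context (G_random : random_graph G) (G_BK : BK_inequality P G).
Local Open Scope ereal_scope.

Definition moment (phi : V -> R) n x : \bar R :=
  itersum phi n (fun s => conn_prob P G s x).

Lemma conn_prob_ge0 s x : 0 <= conn_prob P G s x.
Proof. exact: measure_ge0. Qed.

Lemma conn_prob1 x y : conn_prob P G [:: y] x = tau P G x y.
Proof.
congr (P _); apply/seteqP; split=> w /= H.
  by apply: H; rewrite inE.
by move=> z; rewrite inE => /eqP ->.
Qed.

Lemma moment_ge0 (phi : V -> R) n x : (forall y, 0 <= phi y)%R ->
  0 <= moment phi n x.
Proof. by move=> phi0; apply: itersum_ge0 => // s; exact: conn_prob_ge0. Qed.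

(** The tree-graph inequality summed against [phi]: once the branch point and
    the splitting of the points are fixed, the sums over the two groups of
    points decouple. *)
Lemma moment_recursion (phi : V -> R) n x : (forall y, 0 <= phi y)%R -> (1 < n)%N ->
  moment phi n x <=
  \esum_(z in [set: V]) \sum_(A : {set 'I_n} | (0 < #|A| < n)%N)
    tau P G x z * (moment phi #|A| z * moment phi (n - #|A|) z).
Proof.
move=> phi0 n1.
have c0 s z : 0 <= conn_prob P G s z by exact: conn_prob_ge0.
apply: (le_trans (le_itersum phi0 (fun s sn =>
  tree_graph_inequality V_countable G_random G_BK x sn n1))).
rewrite itersum_esum//; last by move=> z s; rewrite sume_ge0// => A _; rewrite !mule_ge0.
apply: le_esum => z _.
rewrite itersum_sum//; last by move=> A s; rewrite !mule_ge0.
apply: lee_sum => A _; rewrite itersumZl//; last by move=> s; rewrite mule_ge0.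
rewrite conn_prob1 lee_wpmul2l// -[X in itersum _ X _](size_set_mask A).
rewrite (@itersum_mask _ _ _ phi0 _ (fun s => conn_prob P G s z)
  (fun s => conn_prob P G s z))// count_set_mask.
have -> // : count negb (set_mask A) = (n - #|A|)%N.
rewrite -[in RHS](count_set_mask A) -[X in (X - _)%N](size_set_mask A).
by rewrite -(count_predC id) addKn.
Qed.

(** The sum over the subsets [A] of size [k] produces a binomial coefficient
    which the factorials of the two moments turn into [n!].  The parameters [B]
    and [L] of the weight are such that [B * L = C], for the first moment, and
    [8 * B * C * K = 1], so that the constant lost in [conv_weights_le] makes up
    for those of the recursion. *)
Lemma moment_bound (C K : R) (g : V -> V -> R) (phi : V -> R) (h : V -> \bar R) :
  (0 < C)%R -> (0 < K)%R -> (forall y, 0 <= phi y)%R ->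
  (forall x y, 0 <= g x y)%R ->
  (forall x y, tau P G x y <= (C * g x y)%:E) ->
  (forall x, h x = kconv g phi x) ->
  (forall x, \esum_(z in [set: V]) ((g x z)%:E * (h z * h z)) <= K%:E * h x) ->
  forall n x, (0 < n)%N ->
    moment phi n x <=
    (n`!%:R * weight (8 * C * K)^-1 (8 * C ^+ 2 * K) n)%:E * h x.
Proof.
move=> C0 K0 phi0 g0 tauC hE gh.
pose B := ((8 * C * K)^-1)%R; pose L := (8 * C ^+ 2 * K)%R.
pose w := weight B L.
have B0 : (0 < B)%R by rewrite invr_gt0 !mulr_gt0.
have L0 : (0 < L)%R by rewrite !mulr_gt0// exprn_gt0.
have B0l := ltW B0; have L0l := ltW L0; have C0l := ltW C0.
have w0 n : (0 <= w n)%R by exact: weight_ge0.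
have h0 x : 0 <= h x.
  by rewrite hE; apply: esum_ge0 => y _; rewrite lee_fin mulr_ge0.
elim/ltn_ind => -[//|[_|n IH]] x _; rewrite -/B -/L -/w.
  have -> : (1`!%:R * w 1)%R = C.
    rewrite /w /weight /B /L expr1n divr1 mul1r expr1.
    have -> : (8 * C ^+ 2 * K = (8 * C * K) * C)%R by rewrite expr2; lra.
    by rewrite mulKf// lt0r_neq0// !mulr_gt0.
  rewrite hE /kconv -esumZl ?lee_fin//; last first.
    by move=> y; rewrite lee_fin mulr_ge0.
  apply: le_esum => y _; rewrite conn_prob1.
  rewrite -EFinM mulrA EFinM muleC lee_wpmul2r// lee_fin//.
set N := n.+2.
have mom_le k z : (0 < k < N)%N -> moment phi k z <= (k`!%:R * w k)%:E * h z.
  by move=> /andP[k0 kN]; exact: IH.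
pose f k := (k`!%:R * w k * ((N - k)`!%:R * w (N - k)%N))%R.
have f0 k : (0 <= f k)%R by apply: mulr_ge0; apply: mulr_ge0.
pose c := (\sum_(A : {set 'I_N} | (0 < #|A| < N)%N) f #|A|)%R.
have c0 : (0 <= c)%R by apply: sumr_ge0.
apply: (le_trans (moment_recursion x phi0 _)) => //.
apply: (@le_trans _ _ (\esum_(z in [set: V])
    ((C * c)%:E * ((g x z)%:E * (h z * h z))))).
  apply: le_esum => z _.
  have -> : (C * c)%:E * ((g x z)%:E * (h z * h z)) =
      \sum_(A : {set 'I_N} | (0 < #|A| < N)%N)
        (C * g x z)%:E * ((f #|A|)%:E * (h z * h z)).
    rewrite -ge0_sume_distrr; last by move=> A _; rewrite !mule_ge0// lee_fin.
    rewrite -ge0_sume_distrl; last by move=> A _; rewrite lee_fin.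
    by rewrite sumEFin -/c [in RHS]EFinM [in LHS]EFinM !muleA [X in X * _ * _]muleAC.
  apply: lee_sum => A /[dup] /andP[A0 AN] A0N.
  have NA : (0 < N - #|A| < N)%N by lia.
  rewrite lee_pmul ?mule_ge0 ?moment_ge0//.
  rewrite /f EFinM muleACA lee_pmul ?moment_ge0//.
    exact: mom_le.
  exact: mom_le.
rewrite esumZl; last 2 first.
  by rewrite lee_fin mulr_ge0.
  by move=> z; rewrite !mule_ge0// lee_fin.
apply: (@le_trans _ _ ((C * c)%:E * (K%:E * h x))).
  by rewrite lee_wpmul2l// lee_fin mulr_ge0.
rewrite muleA -EFinM lee_wpmul2r// lee_fin.
have cE : (c = N`!%:R * \sum_(1 <= k < N) w k * w (N - k)%N)%R.
  rewrite /c sum_subsets_card mulr_sumr !big_nat.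
  apply: eq_bigr => k /andP[k1 kN].
  by rewrite -(bin_fact (ltnW kN)) !natrM /f; lra.
have /(ler_wpM2l (ler0n _ N`!)) := conv_weights_le N B0l L0l.
rewrite -/w -cE => /(ler_wpM2l (mulr_ge0 C0l (ltW K0))).
rewrite mulrAC => /le_trans; apply.
rewrite (_ : C * K * _ = (8 * C * K) * B * (N`!%:R * w N))%R; last by lra.
by rewrite /B divff ?mul1r// lt0r_neq0// !mulr_gt0.
Qed.

End Moments.

(** * Exponential moments *)

Section ExponentialMoments.
Context {disp : measure_display} {T : measurableType disp} {R : realType}.
Context (V : choiceType) (V_countable : countable [set: V]).
Context (phi : V -> R) (phi_ge0 : forall y, 0 <= phi y).
Local Open Scope ereal_scope.

Lemma measurable_itersum n (F : seq V -> T -> \bar R) :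
  (forall s, measurable_fun [set: T] (F s)) -> (forall s w, 0 <= F s w) ->
  measurable_fun [set: T] (fun w => itersum phi n (fun s => F s w)).
Proof.
elim: n F => [|n IH] F mF F0 /=; first exact: mF.
apply: measurable_esum => // y; last first.
  by move=> w; rewrite mule_ge0 ?lee_fin ?itersum_ge0.
by apply: measurable_funeM; apply: IH.
Qed.

Lemma integral_itersum (mu : {measure set T -> \bar R}) n (F : seq V -> T -> \bar R) :
  (forall s, measurable_fun [set: T] (F s)) -> (forall s w, 0 <= F s w) ->
  \int[mu]_w itersum phi n (fun s => F s w) =
  itersum phi n (fun s => \int[mu]_w F s w).
Proof.
elim: n F => [|n IH] F mF F0 //=.
have mi y : measurable_fun [set: T] (fun w => itersum phi n (fun s => F (y :: s) w)).
  exact: measurable_itersum.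
rewrite integral_esum//; last 2 first.
- by move=> y; apply: measurable_funeM.
- by move=> y w; rewrite mule_ge0 ?lee_fin ?itersum_ge0.
apply: eq_esum => y _; rewrite ge0_integralZl ?lee_fin//; last first.
  by move=> w _; rewrite itersum_ge0.
by rewrite IH.
Qed.

(** Expanding the power gives a sum over sequences of points, in which those
    with all their points in the component of [x] survive. *)
Lemma component_sum_power (H : graph V) x n :
  (\esum_(y in component H x) (phi y)%:E) ^+ n =
  itersum phi n (fun s => (\1_(all_connected s x) H)%:E).
Proof.
have ind0 s : 0 <= (\1_(all_connected s x) H)%:E :> \bar R by rewrite lee_fin indicE.
elim: n => [|n IH].
  by rewrite /= indicE mem_set// => y; rewrite in_nil.
rewrite expeS IH [RHS]/= esum_mkcond -esumZr//; last 2 first.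
- by rewrite itersum_ge0.
- by move=> y; case: ifP => _ //; rewrite lee_fin.
apply: eq_esum => y _.
have -> : (fun s => (\1_(all_connected (y :: s) x) H)%:E) =
    (fun s => (y \in component H x)%:R%:E * (\1_(all_connected s x) H)%:E) :> (_ -> \bar R).
  apply/funext => s; rewrite !indicE -EFinM -natrM mulnb; congr ((nat_of_bool _)%:R%:E).
  apply/idP/andP => [/set_mem Hys|[/set_mem xy /set_mem Hs]].
    split; apply/mem_set; first by apply: Hys; exact: mem_head.
    by move=> z zs; apply: Hys; rewrite inE zs orbT.
  by apply/mem_set => z; rewrite inE => /predU1P[->|/Hs].
rewrite itersumZl//.
by case: (y \in component H x); rewrite ?mul1e// !mul0e mule0.
Qed.

Lemma expeR_series (kappa : R) (S : \bar R) : (0 < kappa)%R -> 0 <= S ->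
  expeR (kappa%:E * S) = \sum_(n <oo) (kappa ^+ n / n`!%:R)%:E * S ^+ n.
Proof.
move=> k0; have c0 n : 0 <= (kappa ^+ n / n`!%:R)%:E :> \bar R.
  by rewrite lee_fin divr_ge0// exprn_ge0// ltW.
case: S => [r r0| _|//]; last first.
  (* the linear term of the series is already infinite *)
  rewrite gt0_muley ?lte_fin//=; apply/esym/eqP; rewrite -leye_eq.
  rewrite nneseries_esumT; last by move=> n; rewrite mule_ge0// expe_ge0// leey.
  rewrite (le_trans _ (ge0_le_esumT 1%N _))//=.
    by rewrite expr1 divr1 gt0_muley ?lte_fin.
  by move=> n; rewrite mule_ge0// expe_ge0// leey.
rewrite -EFinM /= /expR -EFin_lim; last exact: is_cvg_series_exp_coeff.
congr (limn _); apply/funext => N /=.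
rewrite /series/= -sumEFin; apply: eq_bigr => n _.
by rewrite -EFin_expe -EFinM /exp_coeff /= exprMn mulrAC.
Qed.

Context (P : probability T R) (G : T -> graph V) (G_random : random_graph G).

Lemma integral_exp_component (kappa : R) x : (0 < kappa)%R ->
  \int[P]_w expeR (kappa%:E * \esum_(y in component (G w) x) (phi y)%:E) =
  \sum_(n <oo) (kappa ^+ n / n`!%:R)%:E * moment P G phi n x.
Proof.
move=> k0.
have mE s : measurable (G @^-1` all_connected s x).
  by apply: measurable_local => //; exact: local_all_connected.
have mind s : measurable_fun [set: T] (fun w => (\1_(all_connected s x) (G w))%:E : \bar R).
  by apply/measurable_EFinP; exact: measurable_indic (mE s).
have ind0 s w : 0 <= (\1_(all_connected s x) (G w))%:E :> \bar R.
  by rewrite lee_fin indicE.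
have c0 n : 0 <= (kappa ^+ n / n`!%:R)%:E :> \bar R.
  by rewrite lee_fin divr_ge0// exprn_ge0// ltW.
rewrite (eq_integral (fun w => \sum_(n <oo) (kappa ^+ n / n`!%:R)%:E *
    itersum phi n (fun s => (\1_(all_connected s x) (G w))%:E))); last first.
  move=> w _; rewrite expeR_series//; last by apply: esum_ge0 => y _; rewrite lee_fin.
  by apply: eq_eseriesr => n _; rewrite component_sum_power.
rewrite integral_nneseries//; last 2 first.
- by move=> n; apply: measurable_funeM; exact: measurable_itersum.
- by move=> n w _; rewrite mule_ge0 ?itersum_ge0.
apply: eq_eseriesr => n _; rewrite ge0_integralZl//; last 2 first.
- exact: measurable_itersum.
- by move=> w _; rewrite itersum_ge0.
rewrite integral_itersum//; congr (_ * _); apply: eq_itersum => s.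
by rewrite [LHS](integral_indic _ measurableT (mE s)) setIT.
Qed.

End ExponentialMoments.

Theorem theorem1p2 (R : realType) (V : metricType R)
    (V_countable : countable [set: V])
    (d : R) (d_ge1 : 1 <= d) (V_growth : polynomial_volume_growth V d)
    (disp : measure_display) (T : measurableType disp) (P : probability T R)
    (G : T -> graph V) (G_random : random_graph G) (G_BK : BK_inequality P G)
    (alpha : R) (alpha_gt : d / 2 < alpha) (alpha_lt : alpha < d)
    (tau_le : exists2 C : R, 0 < C &
       forall x y : V, (tau P G x y <= (C * gker alpha x y)%:E)%E) :
  exists2 kappa : R, 0 < kappa &
    forall phi : V -> R, (forall y, 0 <= phi y) ->
      (supnorm (kconv (@gker R V (2 * alpha - d)) phi) <= 1)%E ->
      forall x : V,
        (\int[P]_w expeR (kappa%:E * \esum_(y in component (G w) x) (phi y)%:E)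
          <= 2%:E)%E.
Proof.
have alpha_gt0 : 0 < alpha by lra.
have [C0 C00 tauC0] := tau_le.
have [K K1 potential] := potential_bounds V_growth alpha_gt0 alpha_gt alpha_lt.
have K0 : 0 < K by rewrite (lt_le_trans ltr01).
(* [1 <= C] and [1 <= K] ensure [2 * B <= 1] below *)
pose C := C0 + 1.
have C1 : 1 <= C by rewrite lerDr ltW.
have C_gt0 : 0 < C by rewrite (lt_le_trans ltr01).
have tauC x y : (tau P G x y <= (C * gker alpha x y)%:E)%E.
  by rewrite (le_trans (tauC0 x y))// lee_fin ler_wpM2r ?gker_ge0// lerDl.
pose B := (8 * C * K)^-1; pose L := 8 * C ^+ 2 * K.
have B_gt0 : 0 < B by rewrite invr_gt0 !mulr_gt0.
have L_gt0 : 0 < L by rewrite !mulr_gt0// exprn_gt0.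
have B_le : 2 * B <= 1.
  have CK1 : 1 <= C * K by rewrite -[1]mulr1 ler_pM.
  by rewrite /B ler_pdivrMr ?mulr_gt0//; lra.
(* with [kappa * L = 1 / 2], the term of order [n] is at most [2 ^- n] *)
pose kappa := (2 * L)^-1.
have kappa_gt0 : 0 < kappa by rewrite invr_gt0 mulr_gt0.
have kappa_ge0 := ltW kappa_gt0.
exists kappa => // phi phi0 sup_le1 x.
have phi_le1 z : (kconv (gker (2 * alpha - d)) phi z <= 1)%E.
  by rewrite (le_trans (lee_abs _))// (le_trans _ sup_le1)// ereal_sup_ubound//; exists z.
have [h_le2 h_sqr] := potential phi phi0 phi_le1.
rewrite integral_exp_component//.
rewrite nneseries_esumT; last first.
  by move=> n; rewrite mule_ge0 ?moment_ge0// lee_fin divr_ge0// exprn_ge0.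
apply: (@le_trans _ _ (\esum_(n in [set: nat]) ((2^-1 ^+ n : R))%:E)%E); last first.
  apply: esum_nat_le => [n|N]; first by rewrite exprn_ge0// invr_ge0.
  have half01 : 0 < (2^-1 : R) < 1 by apply/andP; split; lra.
  have := geometric_tail_le 0 N half01.
  rewrite expr0 (_ : 1 - 2^-1 = 2^-1 :> R); last by lra.
  by rewrite invrK mul1r.
apply: le_esum => -[_|n _].
  rewrite expr0 divr1 mul1e /moment /= /conn_prob.
  rewrite (_ : G @^-1` _ = setT) ?probability_setT//.
  by apply/seteqP; split=> // w _ y; rewrite in_nil.
have Pn := moment_bound V_countable G_random G_BK C_gt0 K0 phi0
  (gker_ge0 alpha) tauC (fun=> erefl) h_sqr x (ltn0Sn n).
set N := n.+1 in Pn *.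
apply: (le_trans (lee_wpmul2l _ Pn)).
  by rewrite lee_fin divr_ge0// exprn_ge0.
rewrite muleA -EFinM.
have w0 : 0 <= weight B L N by apply: weight_ge0; exact: ltW.
have -> : kappa ^+ N / N`!%:R * (N`!%:R * weight B L N) = kappa ^+ N * weight B L N.
  by rewrite mulrA divfK// pnatr_eq0 -lt0n fact_gt0.
apply: (@le_trans _ _ ((kappa ^+ N * weight B L N)%:E * 2%:E)%E).
  by rewrite lee_wpmul2l// lee_fin mulr_ge0// exprn_ge0.
rewrite -EFinM lee_fin.
have -> : kappa ^+ N * weight B L N * 2 = 2^-1 ^+ N * (2 * B * (N%:R ^+ 2)^-1).
  have -> : kappa ^+ N = 2^-1 ^+ N * (L ^+ N)^-1.
    by rewrite /kappa invfM exprMn [L^-1 ^+ N]exprVn.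
  rewrite /weight; have : (L ^+ N)^-1 * L ^+ N = 1.
    by rewrite mulVf// expf_neq0// lt0r_neq0.
  move: (L ^+ N) (N%:R ^- 2 : R) (2^-1 ^+ N : R) ((L ^+ N)^-1) => l i t l' l'l.
  rewrite (_ : t * l' * (B * l * i) * 2 = (l' * l) * (t * (2 * B * i))); last by lra.
  by rewrite l'l mul1r.
rewrite -[leRHS]mulr1 ler_wpM2l ?exprn_ge0 ?invr_ge0//.
rewrite (le_trans _ B_le)// ler_piMr ?mulr_ge0 ?(ltW B_gt0)//.
by rewrite invf_le1 ?exprn_gt0 ?ltr0n// exprn_ege1// ler1n.
Qed.
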